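(* Let $\{\mathbb{X}_n\}_{n\in\mathbb{N}}$ be a sequence of non-trivial normed linear spaces over $\mathbb{K}$, let $p\in[1,\infty)\cup\{0\}$, and let $x=\{x_n\}_{n\in\mathbb{N}},\,y=\{y_n\}_{n\in\mathbb{N}}\in\bigoplus_p\mathbb{X}_n$. (1) If $p\in(1,\infty)$, then $x\perp_By$ if and only if $$0\in\overline{\operatorname{conv}}\left\{\sum_{n=1}^\infty\|x_n\|^{p-1}f_n(y_n):f_n\in\operatorname{Ext}(J(x_n))\right\},$$ where terms with $x_n=0$ are interpreted as $0$ (and $f_n$ is chosen only for $n$ with $x_n\ne0$). (2) If $p=1$, then $x\perp_By$ if and only if $$\left|\sum_{x_n\neq0}f_n(y_n)\right|\le\sum_{x_n=0}\|y_n\|$$ for some choice of $f_n\in J(x_n)$ (for all $n$ with $x_n\neq0$). (3) If $p=0$ and $x\neq0$, then $x\perp_By$ if and only if $$0\in\overline{\operatorname{conv}}\{f_n(y_n):f_n\in\operatorname{Ext}(J(x_n)),\ \|x_n\|=\|x\|_0\}.$$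
   Context: $\mathbb{K}=\mathbb{R}$ or $\mathbb{C}$; non-trivial means of dimension more than $0$. For $1\le p<\infty$, $\bigoplus_p\mathbb{X}_n$ is the space of sequences $\{x_n\}$ with $x_n\in\mathbb{X}_n$ and $\sum_n\|x_n\|^p<\infty$, with norm $\|\{x_n\}\|_p=(\sum_n\|x_n\|^p)^{1/p}$; $\bigoplus_0\mathbb{X}_n$ is the space of sequences with $\lim_n\|x_n\|=0$, with norm $\|\{x_n\}\|_0=\max_n\|x_n\|$. In a normed space, $x\perp_By$ (Birkhoff-James orthogonality) means $\|x+\lambda y\|\ge\|x\|$ for every scalar $\lambda\in\mathbb{K}$. For non-zero $x\in\mathbb{X}$, $J(x)=\{f\in\mathbb{X}^*:\|f\|=1,\ f(x)=\|x\|\}$. $\operatorname{Ext}(C)$ is the set of extreme points of a convex set $C$, and $\overline{\operatorname{conv}}$ is the closed convex hull (in $\mathbb{K}$). *)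

(* Defs.v *)
From HB Require Import structures.
From mathcomp Require Import all_boot all_order all_algebra.
From mathcomp Require Import complex.
From mathcomp Require Import all_classical all_reals.
From mathcomp Require Import interval_inference.
From mathcomp Require Import topology normedtype sequences convex exp hoelder.

Set Implicit Arguments.
Unset Strict Implicit.
Unset Printing Implicit Defensive.

Import Order.TTheory GRing.Theory Num.Theory.
Import numFieldNormedType.Exports.

Local Open Scope classical_set_scope.
Local Open Scope ring_scope.

Variant RorC (R : realType) : numFieldType -> Type :=
| ScalarsR : RorC R R
| ScalarsC : RorC R R[i].

(* Norms of a normedModType K take their values in K itself. The next two maps
   move between R and the real elements of K; [real_part] is Re when K = R[i]. *)
Definition real_part (R : realType) (K : numFieldType) (h : RorC R K) : K -> R :=
  match h with
  | ScalarsR => fun z : R => z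
  | ScalarsC => fun z : R[i] => complex.Re z
  end.

Definition of_real (R : realType) (K : numFieldType) (h : RorC R K) : R -> K :=
  match h in RorC _ K return R -> K with
  | ScalarsR => fun r : R => r
  | ScalarsC => fun r : R => (r%:C)%C
  end.

Definition rnorm (R : realType) (K : numFieldType) (h : RorC R K)
    (V : normedModType K) (v : V) : R :=
  real_part h `|v|.

Section scalars.
Context {R : realType} {K : numFieldType} (h : RorC R K).

Lemma of_realK r : real_part h (of_real h r) = r.
Proof. by case: K / h. Qed.

Lemma of_real0 : of_real h 0 = 0.
Proof. by case: K / h. Qed.

Lemma of_realD r s : of_real h (r + s) = of_real h r + of_real h s.
Proof. by case: K / h => //=; rewrite rmorphD. Qed.

Lemma of_realM r s : of_real h (r * s) = of_real h r * of_real h s.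
Proof. by case: K / h => //=; rewrite rmorphM. Qed.

Lemma ler_of_real r s : (of_real h r <= of_real h s) = (r <= s).
Proof. by case: K / h => //=; rewrite lecR. Qed.

Lemma real_partK z : 0 <= z -> of_real h (real_part h z) = z.
Proof.
by case: K / h z => //= z z0; rewrite RRe_real// ger0_real.
Qed.

Context {V : normedModType K}.
Implicit Types u v : V.

Lemma rnormE v : of_real h (rnorm h v) = `|v|.
Proof. exact: real_partK. Qed.

Lemma rnorm_ge0 v : 0 <= rnorm h v.
Proof. by rewrite -ler_of_real of_real0 rnormE. Qed.

Lemma rnorm0 : rnorm h (0 : V) = 0.
Proof. by rewrite /rnorm normr0 -of_real0 of_realK. Qed.

Lemma rnorm0_eq0 v : rnorm h v = 0 -> v = 0.
Proof. by move=> v0; apply: normr0_eq0; rewrite -rnormE v0 of_real0. Qed.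

Lemma rnormD u v : rnorm h (u + v) <= rnorm h u + rnorm h v.
Proof. by rewrite -ler_of_real of_realD !rnormE ler_normD. Qed.

Lemma rnormZ (k : K) v : rnorm h (k *: v) = real_part h `|k| * rnorm h v.
Proof.
by apply: (can_inj of_realK); rewrite of_realM !rnormE real_partK// normrZ.
Qed.

Lemma rnormN v : rnorm h (- v) = rnorm h v.
Proof. by rewrite /rnorm normrN. Qed.

End scalars.

(* The exponent 0 stands for c_0, any other one for l^p. *)
Definition lp_mem (R : realType) (p : R) (a : R^nat) : Prop :=
  if p == 0 then a @ \oo --> (0 : R)
  else cvgn (series (fun n => a n `^ p)).

(* On null sequences of nonnegative numbers, the supremum is a maximum. *)
Definition lp_norm (R : realType) (p : R) (a : R^nat) : R :=
  if p == 0 then sup (range a)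
  else limn (series (fun n => a n `^ p)) `^ p^-1.

Section lp_real.
Context {R : realType} {p : R} (hp : p = 0 \/ 1 <= p).
Implicit Types a b : R^nat.

Let p_gt0 : p != 0 -> 0 < p.
Proof. by case: hp => [->|/(lt_le_trans ltr01)//]; rewrite eqxx. Qed.

Let p_ge1 : p != 0 -> 1 <= p.
Proof. by case: hp => [->|//]; rewrite eqxx. Qed.

Let p_ge0 : 0 <= p.
Proof. by case: hp => [->//|/(le_trans ler01)]. Qed.

Let nd_series a : {homo series (fun n => a n `^ p) : m n / (m <= n)%N >-> m <= n}.
Proof. by apply: nondecreasing_series => n _ _; exact: powR_ge0. Qed.

Lemma lp_bounded a M : p != 0 -> 0 <= M ->
  (forall n, series (fun n => a n `^ p) n <= M `^ p) ->
  lp_mem p a /\ lp_norm p a <= M.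
Proof.
move=> p0 M0 aM; rewrite /lp_mem /lp_norm (negbTE p0).
have ca : cvgn (series (fun n => a n `^ p)).
  by apply: nondecreasing_is_cvgn => //; exists (M `^ p) => _ [n _ <-].
split=> //; rewrite -[leRHS](powRr1 M0) -(mulfV p0) powRrM.
apply: ge0_ler_powR; rewrite ?nnegrE ?invr_ge0 ?powR_ge0//.
  apply: limr_ge => //; near=> n; rewrite /series /=.
  by apply: sumr_ge0 => i _; exact: powR_ge0.
by apply: limr_le => //; near=> n; exact: aM.
Unshelve. all: by end_near. Qed.

Lemma series_le_lp_norm a n : p != 0 -> lp_mem p a ->
  series (fun n => a n `^ p) n <= lp_norm p a `^ p.
Proof.
move=> p0; rewrite /lp_mem /lp_norm (negbTE p0) => ca.
rewrite -powRrM mulVf// powRr1.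
  exact: nondecreasing_cvgn_le.
apply: limr_ge => //; near=> m; rewrite /series /=.
by apply: sumr_ge0 => i _; exact: powR_ge0.
Unshelve. all: by end_near. Qed.

Lemma lp_norm_c0_le a M : (forall n, a n <= M) -> lp_norm 0 a <= M.
Proof.
move=> aM; rewrite /lp_norm eqxx; apply: ge_sup; first by exists (a 0%N), 0%N.
by move=> _ [n _ <-].
Qed.

Lemma c0_has_sup a : lp_mem 0 a -> has_sup (range a).
Proof.
rewrite /lp_mem eqxx => ca; split; first by exists (a 0%N), 0%N.
have [M [_ aM]] := cvg_seq_bounded (cvgP _ ca).
exists (M + 1) => _ [n _ <-].
by apply: le_trans (ler_norm _) _; apply: aM => //; rewrite ltrDl.
Qed.

Lemma lp_norm_ge a n : (forall n, 0 <= a n) -> lp_mem p a -> a n <= lp_norm p a.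
Proof.
move=> a0; have [p0|p0] := eqVneq p 0.
  rewrite p0 => /c0_has_sup sa; rewrite /lp_norm eqxx.
  by apply: sup_upper_bound => //; exists n.
move=> ma; have N0 : 0 <= lp_norm p a.
  by rewrite /lp_norm (negbTE p0) powR_ge0.
have : a n `^ p <= lp_norm p a `^ p.
  apply: le_trans (series_le_lp_norm n.+1 p0 ma).
  rewrite /series /= big_nat_recr//= lerDr.
  by apply: sumr_ge0 => i _; exact: powR_ge0.
have pV0 : 0 <= p^-1 by rewrite invr_ge0.
move=> /(ge0_ler_powR pV0); rewrite !nnegrE !powR_ge0.
by move=> /(_ isT isT); rewrite -!powRrM mulfV// !powRr1.
Qed.

Lemma lp_norm_ge0 a : (forall n, 0 <= a n) -> lp_mem p a -> 0 <= lp_norm p a.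
Proof. by move=> a0 /(lp_norm_ge 0 a0); exact: le_trans. Qed.

Lemma lp_norm0_eq0 a : (forall n, 0 <= a n) -> lp_mem p a ->
  lp_norm p a = 0 -> forall n, a n = 0.
Proof.
by move=> a0 ma na n; apply: le_anti; rewrite a0 andbT -na lp_norm_ge.
Qed.

Lemma lp_mem0 : lp_mem p (fun=> 0 : R).
Proof.
have [p0|p0] := eqVneq p 0; first by rewrite p0 /lp_mem eqxx; exact: cvg_cst.
apply: (lp_bounded p0 (lexx 0) _).1 => n.
by rewrite /series /= powR0// big1.
Qed.

Lemma lp_le a b : (forall n, 0 <= a n <= b n) -> lp_mem p b ->
  lp_mem p a /\ lp_norm p a <= lp_norm p b.
Proof.
move=> ab mb.
have a0 n : 0 <= a n by case/andP: (ab n).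
have b0 n : 0 <= b n by case/andP: (ab n) => /le_trans; apply.
have [p0|p0] := eqVneq p 0.
  move: mb (fun n => lp_norm_ge n b0 mb); rewrite p0 {1}/lp_mem eqxx => cb bN.
  have ma : lp_mem 0 a.
    rewrite /lp_mem eqxx; apply: (@squeeze_cvgr _ _ _ _ (fun=> 0) b) => //.
      by near=> n; exact: ab.
    exact: cvg_cst.
  split; first exact: ma.
  apply: lp_norm_c0_le => n; apply: le_trans (bN n).
  by case/andP: (ab n).
apply: lp_bounded => //; first exact: lp_norm_ge0.
move=> n; apply: le_trans (series_le_lp_norm n p0 mb).
rewrite /series /=; apply: ler_sum => i _.
by apply: ge0_ler_powR; rewrite ?nnegrE//; case/andP: (ab i).
Unshelve. all: by end_near. Qed.

Lemma lp_Z_le k a : 0 <= k -> (forall n, 0 <= a n) -> lp_mem p a ->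
  lp_mem p (fun n => k * a n) /\ lp_norm p (fun n => k * a n) <= k * lp_norm p a.
Proof.
move=> k0 a0 ma; have [p0|p0] := eqVneq p 0.
  move: ma (fun n => lp_norm_ge n a0 ma); rewrite p0 {1}/lp_mem eqxx => ca aN.
  split; first by rewrite /lp_mem eqxx -(mulr0 k); exact: cvgMr.
  by apply: lp_norm_c0_le => n; apply: ler_wpM2l.
have N0 := lp_norm_ge0 a0 ma.
apply: lp_bounded => //; first exact: mulr_ge0.
move=> n; rewrite powRM// /series /=.
under eq_bigr do rewrite powRM//.
by rewrite -mulr_sumr ler_wpM2l ?powR_ge0//; exact: series_le_lp_norm.
Qed.

Lemma lp_Z k a : 0 <= k -> (forall n, 0 <= a n) -> lp_mem p a ->
  lp_norm p (fun n => k * a n) = k * lp_norm p a.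
Proof.
move=> k0 a0 ma; have [mka le1] := lp_Z_le k0 a0 ma.
apply: le_anti; rewrite le1/=.
have [k_eq0|kn0] := eqVneq k 0.
  by rewrite {1}k_eq0 mul0r lp_norm_ge0// => n; exact: mulr_ge0.
have kp : 0 < k by rewrite lt_neqAle eq_sym kn0.
rewrite -(ler_pdivlMl (lp_norm p a) (lp_norm p (fun n => k * a n)) kp).
have ki : 0 <= k^-1 by rewrite invr_ge0.
have := (lp_Z_le ki (fun n => mulr_ge0 k0 (a0 n)) mka).2.
by under [X in lp_norm _ X]eq_fun do rewrite mulKf//.
Qed.

Lemma lp_D a b : (forall n, 0 <= a n) -> (forall n, 0 <= b n) ->
  lp_mem p a -> lp_mem p b ->
  lp_mem p (fun n => a n + b n) /\
  lp_norm p (fun n => a n + b n) <= lp_norm p a + lp_norm p b.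
Proof.
move=> a0 b0 ma mb.
have [p0|p0] := eqVneq p 0.
  move: ma mb (fun n => lp_norm_ge n a0 ma) (fun n => lp_norm_ge n b0 mb).
  rewrite p0 {1 2}/lp_mem eqxx => ca cb aN bN.
  split; first by rewrite /lp_mem eqxx -(addr0 (0 : R)); exact: cvgD.
  by apply: lp_norm_c0_le => n; apply: lerD.
set A := lp_norm p a; set B := lp_norm p b.
have A0 : 0 <= A by exact: lp_norm_ge0.
have B0 : 0 <= B by exact: lp_norm_ge0.
have [A_eq0|An0] := eqVneq A 0.
  have az := lp_norm0_eq0 a0 ma A_eq0.
  have -> : (fun n => a n + b n) = b by apply/funext => n; rewrite az add0r.
  by split; [exact: mb|exact: (ler_wpDl A0 (lexx B))].
have [B_eq0|Bn0] := eqVneq B 0.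
  have bz := lp_norm0_eq0 b0 mb B_eq0.
  have -> : (fun n => a n + b n) = a by apply/funext => n; rewrite bz addr0.
  by split; [exact: ma|exact: (ler_wpDr B0 (lexx A))].
have sA n : series (fun n => a n `^ p) n <= A `^ p.
  exact: series_le_lp_norm.
have sB n : series (fun n => b n `^ p) n <= B `^ p.
  exact: series_le_lp_norm.
move: (A) (B) A0 B0 An0 Bn0 sA sB => {}A {}B A0 B0 An0 Bn0 sA sB.
have Ap : 0 < A by rewrite lt_neqAle eq_sym An0.
have Bp : 0 < B by rewrite lt_neqAle eq_sym Bn0.
have ABp : 0 < A + B by exact: addr_gt0.
have AB0 : 0 <= A + B by exact: ltW.
have ABn0 : A + B != 0 by rewrite gt_eqF.
have t01 : 0 <= A / (A + B) <= 1.
  by rewrite divr_ge0//= ler_pdivrMr// mul1r lerDl.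
have tE : 1 - A / (A + B) = B / (A + B).
  by rewrite -[X in X - _](mulfV ABn0) -mulrBl addrC addKr.
apply: lp_bounded => //.
move=> n.
have key i : (a i + b i) `^ p <= (A + B) `^ p *
    (A / (A + B) * (a i `^ p / A `^ p) + B / (A + B) * (b i `^ p / B `^ p)).
  have aA : 0 <= a i / A by exact: divr_ge0.
  have bB : 0 <= b i / B by exact: divr_ge0.
  have {1}-> : a i + b i =
      (A + B) * (A / (A + B) * (a i / A) + B / (A + B) * (b i / B)).
    rewrite mulrDr !mulrA [(A + B) * A]mulrC [(A + B) * B]mulrC.
    by rewrite !mulfK// [A * _]mulrC [B * _]mulrC !mulfK.
  have tA : 0 <= A / (A + B) by exact: divr_ge0.
  have tB : 0 <= B / (A + B) by exact: divr_ge0.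
  rewrite (powRM _ AB0); last first.
    by apply: addr_ge0; apply: mulr_ge0.
  apply: ler_wpM2l; first exact: powR_ge0.
  have powRV0 (u v : R) : 0 <= u -> 0 <= v -> u `^ p / v `^ p = (u / v) `^ p.
    move=> u0 v0; rewrite powRM ?invr_ge0//; congr (_ * _).
    by rewrite -powRN -mulN1r powRrM powR_inv1.
  rewrite !powRV0//.
  case/andP: t01 => t0 t1; pose t := Itv01 t0 t1.
  have := @convex_powR _ p (p_ge1 p0) t (a i / A) (b i / B).
  rewrite !inE/= !in_itv/= !andbT convRE [X in X `^ _ <= _]convRE/=.
  by rewrite /unstable.onem tE; apply.
rewrite /series /=; apply: le_trans (ler_sum _ (fun i _ => key i)) _.
rewrite -mulr_sumr -[leRHS]mulr1 ler_wpM2l ?powR_ge0//.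
rewrite big_split /= -!mulr_sumr -!mulr_suml -[leRHS](subrK (A / (A + B))) tE.
rewrite addrC lerD// -[leRHS]mulr1 ler_wpM2l ?divr_ge0//.
- by rewrite ler_pdivrMr ?powR_gt0// mul1r; exact: sB.
- by rewrite ler_pdivrMr ?powR_gt0// mul1r; exact: sA.
Qed.

End lp_real.

(* The proof [hp] is a parameter so that the normed module structure below can
   be inferred from the type alone. *)
Record direct_sum (R : realType) (K : numFieldType) (h : RorC R K) (p : R)
    (hp : p = 0 \/ 1 <= p) (X : nat -> normedModType K) := DirectSum {
  dsum_seq :> forall n, X n;
  dsum_memP : lp_mem p (fun n => rnorm h (dsum_seq n)) }.

Section direct_sum.
Context {R : realType} {K : numFieldType} (h : RorC R K).
Context {p : R} (hp : p = 0 \/ 1 <= p) (X : nat -> normedModType K).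

Local Notation direct_sum := (direct_sum h hp X).
Local Notation DirectSum := (@DirectSum R K h p hp X _).
Implicit Types x y z : direct_sum.

Lemma direct_sum_eq x y : (forall n, x n = y n) -> x = y.
Proof.
case: x y => [x mx] [y my] /= xy.
have {xy}xy : x = y by exact: functional_extensionality_dep.
by rewrite xy in mx *; congr DirectSum; exact: Prop_irrelevance.
Qed.

Let nge0 x n : 0 <= rnorm h (x n). Proof. exact: rnorm_ge0. Qed.

Lemma dsum_zero_mem : lp_mem p (fun n => rnorm h (0 : X n)).
Proof.
by under eq_fun do rewrite rnorm0; exact: lp_mem0.
Qed.

Lemma dsum_opp_mem x : lp_mem p (fun n => rnorm h (- x n)).
Proof. by under eq_fun do rewrite rnormN; exact: dsum_memP. Qed.

Lemma dsum_add_mem x y : lp_mem p (fun n => rnorm h (x n + y n)).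
Proof.
have [m _] := lp_D hp (nge0 x) (nge0 y) (dsum_memP x) (dsum_memP y).
by apply: (lp_le hp _ m).1 => n; rewrite rnorm_ge0 rnormD.
Qed.

Lemma dsum_scale_mem (k : K) x : lp_mem p (fun n => rnorm h (k *: x n)).
Proof.
under eq_fun do rewrite rnormZ.
apply: (lp_Z_le hp _ (nge0 x) (dsum_memP x)).1.
by rewrite -(ler_of_real h) of_real0 real_partK.
Qed.

Definition dsum_zero := DirectSum dsum_zero_mem.
Definition dsum_opp x := DirectSum (dsum_opp_mem x).
Definition dsum_add x y := DirectSum (dsum_add_mem x y).
Definition dsum_scale (k : K) x := DirectSum (dsum_scale_mem k x).
Definition dsum_norm x : K := of_real h (lp_norm p (fun n => rnorm h (x n))).

HB.instance Definition _ := gen_eqMixin direct_sum.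
HB.instance Definition _ := gen_choiceMixin direct_sum.

Let addA : associative dsum_add.
Proof. by move=> x y z; apply: direct_sum_eq => n; exact: addrA. Qed.

Let addC : commutative dsum_add.
Proof. by move=> x y; apply: direct_sum_eq => n; exact: addrC. Qed.

Let add0 : left_id dsum_zero dsum_add.
Proof. by move=> x; apply: direct_sum_eq => n; exact: add0r. Qed.

Let addN : left_inverse dsum_zero dsum_opp dsum_add.
Proof. by move=> x; apply: direct_sum_eq => n; exact: addNr. Qed.

HB.instance Definition _ :=
  GRing.isZmodule.Build direct_sum addA addC add0 addN.

Let scaleA k l x : dsum_scale k (dsum_scale l x) = dsum_scale (k * l) x.
Proof. by apply: direct_sum_eq => n; exact: scalerA. Qed.

Let scale1 : left_id 1 dsum_scale.
Proof. by move=> x; apply: direct_sum_eq => n; exact: scale1r. Qed.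

Let scaleDr : right_distributive dsum_scale +%R.
Proof. by move=> k x y; apply: direct_sum_eq => n; exact: scalerDr. Qed.

Let scaleDl x : {morph dsum_scale^~ x : k l / k + l}.
Proof. by move=> k l; apply: direct_sum_eq => n; exact: scalerDl. Qed.

HB.instance Definition _ := GRing.Zmodule_isLmodule.Build K direct_sum
  scaleA scale1 scaleDr scaleDl.

Let normD x y : dsum_norm (x + y) <= dsum_norm x + dsum_norm y.
Proof.
rewrite /dsum_norm -of_realD ler_of_real.
have [m] := lp_D hp (nge0 x) (nge0 y) (dsum_memP x) (dsum_memP y).
apply: le_trans; apply: (lp_le hp _ m).2 => n.
by rewrite rnorm_ge0 rnormD.
Qed.

Let normZ (k : K) x : dsum_norm (k *: x) = `|k| * dsum_norm x.
Proof.
rewrite /dsum_norm -[in RHS](real_partK h (normr_ge0 k)) -of_realM.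
rewrite -(lp_Z hp _ (nge0 x) (dsum_memP x)); last first.
  by rewrite -(ler_of_real h) of_real0 real_partK.
by congr (of_real h (lp_norm p _)); apply/funext => n; rewrite rnormZ.
Qed.

Let norm0_eq0 x : dsum_norm x = 0 -> x = 0.
Proof.
move=> /(congr1 (real_part h)); rewrite of_realK.
rewrite -[in X in _ = X -> _](of_real0 h) of_realK => x0.
apply: direct_sum_eq => n; apply: (rnorm0_eq0 (h := h)).
exact: (lp_norm0_eq0 hp (nge0 x) (dsum_memP x) x0 n).
Qed.

HB.instance Definition _ :=
  Lmodule_isNormed.Build K direct_sum normD normZ norm0_eq0.

End direct_sum.

Definition birkhoff_james (K : numFieldType) (V : normedModType K)
    (x y : V) : Prop :=
  forall k : K, `|x| <= `|x + k *: y|.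

Definition dual_norm (R : realType) (K : numFieldType) (h : RorC R K)
    (V : normedModType K) (f : V -> K^o) : R :=
  sup [set rnorm h (f v) | v in [set v : V | `|v| <= 1]].

(* The set J(x), inside the K-vector space of all functions V -> K. *)
Definition support_functionals (R : realType) (K : numFieldType) (h : RorC R K)
    (V : normedModType K) (x : V) : set (V -> K^o) :=
  [set f | [/\ linear f, continuous f, dual_norm h f = 1 & f x = `|x|]].

(* For t in K, [0 < t < 1] forces t to be real. *)
Definition extreme_points (K : numFieldType) (E : lmodType K) (C : set E) :
    set E :=
  [set f | C f /\ forall (g1 g2 : E) (t : K), C g1 -> C g2 -> 0 < t < 1 ->
    f = t *: g1 + (1 - t) *: g2 -> g1 = f /\ g2 = f].

(* The weights of [convex_set] are elements of K lying in [0, 1], hence real. *)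
Definition closed_conv (K : numFieldType) (V : normedModType K) (A : set V) :
    set V :=
  closure (smallest (@convex_set K V) A : set V).

(* Main.v *)
(* Duality, in three steps.
   - A minimal "facial" sublinear functional is linear and extreme, so one use of
     Zorn's lemma gives both the Hahn-Banach theorem and, for every v, an extreme
     point of J(x) at which Re f(v) is maximal over J(x).
   - If x _|_B y, some norm-one functional F attains its norm at x and kills y
     (James). For p >= 1, differentiating |x + t w|^p for w supported in the n-th
     coordinate shows that |x|^(p-1) F restricted to X_n is |x_n|^(p-1) f_n with
     f_n in J(x_n); summing over n gives (2), and (1) after replacing f_n by
     extreme points that do better in a given direction. Conversely the tangent
     inequality p b^(p-1) (a - b) <= a^p - b^p bounds |x + k y|^p from below.
   - 0 is in the closed convex hull of a bounded set A of scalars iff no linear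
     form z |-> Re (k z) is bounded above on A by a negative constant. For p = 0,
     such a k would give a direction in which the norm of the finitely many
     coordinates of maximal norm decreases, hence the norm of x. *)

Require Import Defs.
From HB Require Import structures.
From mathcomp Require Import all_boot all_order all_algebra.
From mathcomp Require Import complex ring lra.
From mathcomp Require Import all_classical all_reals.
From mathcomp Require Import interval_inference.
From mathcomp Require Import topology normedtype sequences derive realfun convex exp.

Set Implicit Arguments.
Unset Strict Implicit.
Unset Printing Implicit Defensive.

Import Order.TTheory GRing.Theory Num.Theory.
Import numFieldNormedType.Exports.

Local Open Scope classical_set_scope.
Local Open Scope ring_scope.

(** * Sublinear functionals *)

Section sublinear.
Context {R : realType} {K : numFieldType} (h : RorC R K) {V : lmodType K}.
Implicit Types (q f g : V -> R) (u v x : V) (r t : R).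

Local Notation "r *% v" := (of_real h r *: v) (at level 40).

Lemma of_real1 : of_real h 1 = 1. Proof. by case: K / h. Qed.
Lemma of_realN r : of_real h (- r) = - of_real h r.
Proof. by case: K / h => //=; rewrite rmorphN. Qed.

(** Homogeneity concerns real scalars only, acting through [of_real]: [V] is treated as a real
    vector space even when [K] is complex. *)
Definition sublinear q :=
  (forall u v, q (u + v) <= q u + q v) /\
  (forall r v, 0 <= r -> q (r *% v) = r * q v).

Definition rlinear f := forall r u v, f (r *% u + v) = r * f u + f v.

Lemma rlinearD f u v : rlinear f -> f (u + v) = f u + f v.
Proof. by move=> /(_ 1 u v); rewrite of_real1 scale1r mul1r. Qed.

Lemma rlinear0 f : rlinear f -> f 0 = 0.
Proof. by move=> /(rlinearD 0 0); rewrite addr0; lra. Qed.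

Lemma rlinearZ f r u : rlinear f -> f (r *% u) = r * f u.
Proof. by move=> fl; rewrite -[_ *: _]addr0 fl rlinear0// addr0. Qed.

Lemma rlinearN f u : rlinear f -> f (- u) = - f u.
Proof.
move=> fl; have := rlinearD u (- u) fl; rewrite subrr (rlinear0 fl); lra.
Qed.

Lemma sublinear0 q : sublinear q -> q 0 = 0.
Proof. by case=> _ /(_ 0 0 (lexx 0)); rewrite scaler0 mul0r. Qed.

Lemma sublinear_oppr q v : sublinear q -> - q (- v) <= q v.
Proof.
by move=> sq; have := sq.1 v (- v); rewrite subrr sublinear0// -lerBlDr sub0r.
Qed.

(** The upper bound for [r > 0] suffices: applied with factor [r^-1] to the vector [r *% v], it
    gives the reverse inequality. *)
Lemma sublinearP q : (forall u v, q (u + v) <= q u + q v) -> q 0 = 0 ->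
  (forall r v, 0 < r -> q (r *% v) <= r * q v) -> sublinear q.
Proof.
move=> qD q0 qZ; split=> // r v; rewrite le_eqVlt => /predU1P[<-|r0].
  by rewrite of_real0 scale0r q0 mul0r.
apply/le_anti; rewrite qZ//=.
have := qZ r^-1 (r *% v); rewrite invr_gt0 => /(_ r0).
by rewrite scalerA -of_realM mulVf ?gt_eqF// of_real1 scale1r mulrC ler_pdivlMr// mulrC.
Qed.

(** Oddness reverses subadditivity: [q w = q ((w + z) - z) <= q (w + z) - q z]. *)
Lemma sublinear_odd_rlinear q : sublinear q ->
  (forall v, q (- v) <= - q v) -> rlinear q.
Proof.
move=> sq qN r u v.
have qNE w : q (- w) = - q w.
  by apply/le_anti; rewrite qN/= lerNl sublinear_oppr.
have qD w z : q (w + z) = q w + q z.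
  apply/le_anti; rewrite sq.1/=.
  by have := sq.1 (w + z) (- z); rewrite addrK qNE; lra.
rewrite qD; congr +%R; have [r0|r0] := leP 0 r; first exact: sq.2.
rewrite -[r]opprK of_realN scaleNr qNE sq.2 ?mulNr// oppr_ge0; exact: ltW.
Qed.

(* The support function of the face [f x = q x] of [{f | f <= q}]. *)
Definition face_fun q x v := inf [set q (v + r *% x) - r * q x | r in `[0, +oo[].

Section face_fun.
Variables (q : V -> R) (x : V).
Hypothesis sq : sublinear q.

Lemma face_fun_lb v : lbound [set q (v + r *% x) - r * q x | r in `[0, +oo[] (- q (- v)).
Proof.
move=> _ [r + <-]; rewrite /= in_itv/= andbT => r0.
by have := sq.1 (v + r *% x) (- v); rewrite addrC addKr sq.2//; lra.
Qed.

Lemma face_fun_le r v : 0 <= r -> face_fun q x v <= q (v + r *% x) - r * q x.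
Proof.
move=> r0; apply: ge_inf; first by exists (- q (- v)); exact: face_fun_lb.
by exists r => //; rewrite /= in_itv/= r0.
Qed.

Lemma le_face_fun v c : (forall r, 0 <= r -> c <= q (v + r *% x) - r * q x) ->
  c <= face_fun q x v.
Proof.
move=> cq; apply: lb_le_inf; first by eexists; exists 0 => //; rewrite /= in_itv/= lexx.
by move=> _ [r + <-]; rewrite /= in_itv/= andbT => /cq.
Qed.

Lemma face_funW v : face_fun q x v <= q v.
Proof.
by apply: le_trans (face_fun_le v (lexx 0)) _; rewrite of_real0 scale0r addr0; lra.
Qed.

(** This is the term [r = 1] of the infimum. It forces every odd functional below [face_fun q x] to
    be at least [q x] at [x]. *)
Lemma face_funN : face_fun q x (- x) <= - q x.
Proof.
have := face_fun_le (- x) ler01.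
by rewrite of_real1 scale1r addNr sublinear0//; lra.
Qed.

Lemma face_fun_sublinear : sublinear (face_fun q x).
Proof.
apply: sublinearP.
- move=> u v; rewrite -lerBlDr; apply: le_face_fun => r r0.
  rewrite lerBlDl -lerBlDr; apply: le_face_fun => s s0.
  have := face_fun_le (u + v) (addr_ge0 r0 s0).
  rewrite of_realD scalerDl addrACA.
  have := sq.1 (u + r *% x) (v + s *% x); lra.
- apply/le_anti/andP; split; first by rewrite -[leRHS](sublinear0 sq) face_funW.
  apply: le_face_fun => r r0.
  by rewrite add0r sq.2// subrr.
- move=> r v r0; rewrite -ler_pdivrMl//; apply: le_face_fun => s s0.
  rewrite ler_pdivrMl//; apply: le_trans (face_fun_le _ (mulr_ge0 (ltW r0) s0)) _.
  by rewrite of_realM -scalerA -scalerDr sq.2 ?(ltW r0)//; lra.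
Qed.

End face_fun.

(** Says that the linear functionals below [q] form a face of the convex set of those below [q0].
    The same conclusion for [g] follows by exchanging [f] and [g] and replacing [t] by [1 - t]. *)
Definition facial q0 q :=
  [/\ sublinear q, (forall v, q v <= q0 v) &
   forall f g t, rlinear f -> rlinear g -> (forall v, f v <= q0 v) ->
     (forall v, g v <= q0 v) -> 0 < t < 1 ->
     (forall v, t * f v + (1 - t) * g v <= q v) -> forall v, f v <= q v].

(** A face of a face is a face. *)
Lemma facial_face_fun q0 q x : facial q0 q -> facial q0 (face_fun q x).
Proof.
move=> [sq qq0 qF]; split.
- exact: face_fun_sublinear.
- by move=> v; apply: le_trans (face_funW _ sq _) (qq0 v).
move=> f g t fl gl fq0 gq0 t01 fg v.
have fgq u : t * f u + (1 - t) * g u <= q u.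
  exact: le_trans (fg u) (face_funW _ sq _).
have fq := qF _ _ _ fl gl fq0 gq0 t01 fgq.
have gq : forall u, g u <= q u.
  apply: (qF g f (1 - t)) => //; first lra.
  by move=> u; have := fgq u; lra.
(* The combination must reach [q x] at [x], while neither [f x] nor [g x] exceeds it; so [f] attains
   [q] at [x], and [f <= q] at [v + r *% x] becomes the bound by [face_fun q x v]. *)
have fx : f x = q x.
  apply/le_anti; rewrite fq/=.
  have := le_trans (fg (- x)) (face_funN x sq); rewrite !rlinearN//.
  by have := gq x; nra.
apply: le_face_fun => r r0; have := fq (v + r *% x).
by rewrite addrC fl fx [_ + v]addrC; lra.
Qed.

(** Provides the lower bounds of chains for Zorn's lemma. *)
Lemma facial_chain_inf q0 (A : set (V -> R)) : A !=set0 ->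
  A `<=` facial q0 ->
  (forall q1 q2, A q1 -> A q2 -> (forall v, q1 v <= q2 v) \/ (forall v, q2 v <= q1 v)) ->
  facial q0 (fun v => inf [set q v | q in A]) /\
  forall q, A q -> forall v, inf [set q v | q in A] <= q v.
Proof.
move=> [q1 Aq1] AF Atot.
have infA q v : A q -> inf [set q v | q in A] <= q v.
  move=> Aq; apply: ge_inf; last by exists q.
  exists (- q0 (- v)) => _ [q' /AF[sq' q'q0 _] <-].
  by apply: le_trans (sublinear_oppr v sq'); rewrite lerN2.
have leA v c : (forall q, A q -> c <= q v) -> c <= inf [set q v | q in A].
  by move=> cq; apply: lb_le_inf; [exists (q1 v), q1|move=> _ [q Aq <-]; exact: cq].
split; last by move=> q Aq v; exact: infA.
split.
- apply: sublinearP.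
  + move=> u v; rewrite -lerBlDr; apply/leA => q Aq.
    rewrite lerBlDl -lerBlDr; apply/leA => q' Aq'; rewrite lerBlDl.
    have [[sq _ _] [sq' _ _]] := (AF _ Aq, AF _ Aq').
    (* Infima of sublinear functionals need not be subadditive; in a chain, the smaller of [q] and
       [q'] can be used at [u + v]. *)
    have [qq'|q'q] := Atot _ _ Aq Aq'.
      by apply: le_trans (infA _ _ Aq) _; have := sq.1 u v; have := qq' v; lra.
    by apply: le_trans (infA _ _ Aq') _; have := sq'.1 u v; have := q'q u; lra.
  + apply/le_anti/andP; split.
      by have [sq _ _] := AF _ Aq1; rewrite -(sublinear0 sq) infA.
    by apply/leA => q /AF[sq _ _]; rewrite sublinear0.
  + move=> r v r0; rewrite -ler_pdivrMl//; apply/leA => q Aq.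
    have [sq _ _] := AF _ Aq; rewrite ler_pdivrMl// -sq.2 ?(ltW r0)//.
    exact: infA.
- by move=> v; have [_ q1q0 _] := AF _ Aq1; apply: le_trans (q1q0 v); exact: infA.
- move=> f g t fl gl fq0 gq0 t01 fg v; apply/leA => q Aq.
  have [_ _ qF] := AF _ Aq; apply: (qF f g t) => // u.
  by apply: le_trans (fg u) _; exact: infA.
Qed.

(* Hahn-Banach and Krein-Milman at once: a minimal facial [q] equals all its
   [face_fun q v], hence is odd, hence linear, and a linear facial functional is
   an extreme point. *)
Theorem extreme_rlinear_below q0 x : sublinear q0 ->
  exists f, [/\ rlinear f, (forall v, f v <= q0 v), facial q0 f &
    f x = q0 x /\ forall v, f v <= face_fun q0 x v].
Proof.
move=> sq0.
have F0 : facial q0 q0 by split=> //.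
pose P q := facial q0 q /\ forall v, q v <= face_fun q0 x v.
pose T := {q | P q}.
(* The order is reversed, so a maximal element is a minimal functional. Staying below
   [face_fun q0 x] secures the value [q0 x] at [x]. *)
pose le_T (s t : T) := `[< forall v, sval t v <= sval s v >].
have T0 : P (face_fun q0 x).
  by split=> //; exact: facial_face_fun.
have [||A Atot|t tmax] := @ZL_preorder T (exist P _ T0) le_T.
- by move=> t; apply/asboolP.
- by move=> s t u /asboolP st /asboolP tu; apply/asboolP => v; exact: le_trans (tu v) _.
- have [A0|/set0P[s As]] := eqVneq A set0.
    by exists (exist P _ T0) => s; rewrite A0.
  have [|||FA infA] := @facial_chain_inf q0 [set sval t | t in A].
  + by exists (sval s), s.
  + by move=> _ [[q [qF ?]] _ <-].
  + move=> _ _ [t At <-] [u Au <-].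
    by have [/asboolP|/asboolP] := Atot _ _ At Au; [right|left].
  + have TA : P (fun v => inf [set q v | q in [set sval t | t in A]]).
      split=> // v; apply: le_trans (infA (sval s) _ v) _; first by exists s.
      exact: (svalP s).2.
    exists (exist P _ TA) => u Au; apply/asboolP => v /=.
    by apply: infA; exists u.
have [[sf fq0 fF] fx] := svalP t.
have ft v : face_fun (sval t) v =1 sval t.
  have Tv : P (face_fun (sval t) v).
    split; first by apply: facial_face_fun; split.
    by move=> u; apply: le_trans (face_funW _ sf _) _; exact: fx.
  have /= := tmax (exist P _ Tv); rewrite /le_T /= => tm u.
  apply/le_anti; rewrite face_funW//=.
  by have /asboolP := tm (asboolT (face_funW v sf)).
exists (sval t).
have fl : rlinear (sval t).
  by apply: sublinear_odd_rlinear => // v; rewrite -[in leLHS](ft v) face_funN.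
split=> //; split=> //; apply/le_anti; rewrite fq0/=.
by have := le_trans (fx (- x)) (face_funN x sq0); rewrite rlinearN// lerN2.
Qed.

End sublinear.

(** * The scalar field *)

Section scalar_field.
Context {R : realType} {K : numFieldType} (h : RorC R K).
Implicit Types (z w : K) (r s : R).

Local Notation re := (real_part h).
Local Notation abs z := (rnorm h (z : K^o)).

Lemma real_partD z w : re (z + w) = re z + re w.
Proof. by case: K / h z w => //= z w; rewrite raddfD. Qed.

Lemma real_partN z : re (- z) = - re z.
Proof. by case: K / h z => //= z; rewrite raddfN. Qed.

Lemma real_part0 : re 0 = 0.
Proof. by case: K / h. Qed.

Lemma real_partZ r z : re (of_real h r * z) = r * re z.
Proof. by case: K / h z => //= -[a b] /=; rewrite mul0r subr0. Qed.

Lemma real_part_sum (I : Type) (s : seq I) (P : pred I) (F : I -> K) :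
  re (\sum_(i <- s | P i) F i) = \sum_(i <- s | P i) re (F i).
Proof. by apply: (big_morph re); [exact: real_partD|exact: real_part0]. Qed.

Lemma of_real_sum (I : Type) (s : seq I) (P : pred I) (F : I -> R) :
  of_real h (\sum_(i <- s | P i) F i) = \sum_(i <- s | P i) of_real h (F i).
Proof. by apply: (big_morph _ (of_realD h)); exact: of_real0. Qed.

Lemma ltr_of_real r s : (of_real h r < of_real h s) = (r < s).
Proof. by rewrite !lt_neqAle ler_of_real (inj_eq (can_inj (of_realK h))). Qed.

Lemma normr_of_real r : `|of_real h r| = of_real h `|r|.
Proof.
have [r0|r0] := leP 0 r.
  by rewrite (ger0_norm r0); apply: ger0_norm; rewrite -(of_real0 h) ler_of_real.
rewrite (ltr0_norm r0) of_realN; apply: ltr0_norm.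
by rewrite -(of_real0 h) ltr_of_real.
Qed.

Lemma rnorm_of_real r : abs (of_real h r) = `|r|.
Proof. by rewrite /rnorm normr_of_real of_realK. Qed.

Lemma rnormM z w : abs (z * w) = abs z * abs w.
Proof. exact: rnormZ. Qed.

Lemma ler_rnorm (V W : normedModType K) (v : V) (w : W) :
  (`|v| <= `|w|) = (rnorm h v <= rnorm h w).
Proof. by rewrite -!(rnormE h) ler_of_real. Qed.

Lemma rnorm_sqrD r z :
  abs (of_real h r + z) ^+ 2 = r ^+ 2 + 2 * r * re z + abs z ^+ 2.
Proof.
rewrite /rnorm; case: K / h z => /= [z|[a b]].
  by rewrite !real_normK ?num_real//; ring.
by rewrite !sqr_sqrtr ?addr_ge0 ?sqr_ge0//=; ring.
Qed.

Lemma real_part_le z : re z <= abs z.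
Proof.
rewrite /rnorm; case: K / h z => /= [z|[a b]]; first exact: ler_norm.
apply: le_trans (ler_norm _) _; rewrite -sqrtr_sqr ler_wsqrtr// lerDl sqr_ge0//.
Qed.

Lemma real_part_normr_le z : `|re z| <= abs z.
Proof.
by rewrite ler_norml real_part_le andbT lerNl -real_partN -rnormN real_part_le.
Qed.

(** Equality case of [re z <= abs z]: by [rnorm_sqrD], the squared distance from [z] to its modulus
    vanishes. *)
Lemma real_part_eq_rnorm z : abs z <= re z -> z = of_real h (abs z).
Proof.
move=> zz; have {}zz : re z = abs z by apply/le_anti; rewrite real_part_le zz.
have := rnorm_sqrD (- abs z) z; rewrite zz => e.
have : abs (of_real h (- abs z) + z) ^+ 2 = 0 by rewrite e; lra.
move=> /eqP; rewrite sqrf_eq0 => /eqP /rnorm0_eq0 /eqP.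
by rewrite of_realN addrC subr_eq0 => /eqP.
Qed.

Lemma exists_phase z : exists u : K, abs u = 1 /\ u * z = of_real h (abs z).
Proof.
have [->|z0] := eqVneq z 0.
  exists 1; rewrite mulr0 rnorm0 of_real0; split=> //.
  by rewrite /rnorm normr1 -(of_real1 h) of_realK.
exists (of_real h (abs z) / z); rewrite divfK//; split=> //.
rewrite rnormE /rnorm normrM normr_id normfV mulfV ?normr_eq0//.
by rewrite -(of_real1 h) of_realK.
Qed.

Lemma real_part_inj z w : (forall k, re (k * z) = re (k * w)) -> z = w.
Proof.
move=> zw; have [u [_ uE]] := exists_phase (z - w).
apply/eqP; rewrite -subr_eq0; apply/eqP/(rnorm0_eq0 (h := h) (V := K^o)).
by rewrite -[LHS](of_realK h) -uE mulrBr real_partD real_partN zw subrr.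
Qed.

Lemma cvg_rnormP (u : K ^nat) z :
  u @ \oo --> (z : K^o) <-> (fun n => abs (z - u n)) @ \oo --> (0 : R).
Proof.
split=> [/cvgrPdist_lt uz|/cvgrPdist_lt uz]; apply/cvgrPdist_lt => e e0.
  have := uz (of_real h e); rewrite -{1}(of_real0 h) ltr_of_real => /(_ e0).
  apply: filterS => n; rewrite -(rnormE h (V := K^o)) ltr_of_real.
  by rewrite sub0r normrN ger0_norm// rnorm_ge0.
have eE : of_real h (re e) = e by rewrite real_partK// ltW.
have := uz (re e); rewrite -(ltr_of_real) of_real0 eE => /(_ e0).
apply: filterS => n; rewrite sub0r normrN ger0_norm ?rnorm_ge0//.
by rewrite -ltr_of_real rnormE eE.
Qed.

Lemma real_part_cvg (u : K ^nat) z k : u @ \oo --> (z : K^o) ->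
  (fun n => re (k * u n)) @ \oo --> re (k * z).
Proof.
move=> /cvg_rnormP uz; apply/cvgrPdist_le => e e0.
have k1 : 0 < abs k + 1 by have := rnorm_ge0 h (k : K^o); lra.
move/cvgrPdist_le : uz => /(_ _ (divr_gt0 e0 k1)).
apply: filterS => n; rewrite sub0r normrN ger0_norm ?rnorm_ge0// => un.
rewrite -real_partN -real_partD -mulrBr.
apply: le_trans (real_part_normr_le _) _; rewrite rnormM.
move: un; rewrite ler_pdivlMr//.
by have := rnorm_ge0 h (z - u n : K^o); nra.
Qed.

Lemma of_real_cvg (u : R ^nat) r : u @ \oo --> r ->
  (fun n => of_real h (u n)) @ \oo --> (of_real h r : K^o).
Proof.
move=> ur; apply/cvg_rnormP; apply/cvgrPdist_le => e e0.
move/cvgrPdist_le : ur => /(_ _ e0); apply: filterS => n.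
by rewrite -of_realN -of_realD rnorm_of_real sub0r normrN normr_id.
Qed.

Lemma rnorm_cvg (u : K ^nat) z : u @ \oo --> (z : K^o) ->
  (fun n => abs (u n)) @ \oo --> abs z.
Proof.
move=> /cvg_rnormP uz; apply/cvgrPdist_le => e e0.
move/cvgrPdist_le : uz => /(_ _ e0); apply: filterS => n.
rewrite sub0r normrN ger0_norm ?rnorm_ge0// => uze.
have := rnormD h (z - u n : K^o) (u n); rewrite subrK.
have := rnormD h (u n - z : K^o) z; rewrite subrK -(rnormN h (u n - z : K^o)) opprB.
by rewrite ler_distl; lra.
Qed.

(** In the complex case, [k = 1] and [k = - 'i] extract the real and the imaginary parts. *)
Lemma real_part_is_cvg (u : K ^nat) : (forall k, cvgn (fun n => re (k * u n))) ->
  cvgn (u : nat -> K^o).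
Proof.
case: K / h u => u cu /=.
  by have := cu 1; under eq_fun do rewrite mul1r.
have /cvg_ex[a /= ua] := cu 1.
have /cvg_ex[b /= ub] := cu (- 'i)%C.
apply/cvg_ex; exists (a +i* b)%C; apply/cvgrPdist_lt => /= e e0.
have [e1 eE] : 0 < complex.Re e /\ (complex.Re e)%:C%C = e.
  by case: e e0 => e1 e2 /=; rewrite ltcE /= => /andP[/eqP -> ].
rewrite -eE.
move/cvgrPdist_lt : ua => /(_ _ (divr_gt0 e1 (ltr0Sn _ 1))) ua.
move/cvgrPdist_lt : ub => /(_ _ (divr_gt0 e1 (ltr0Sn _ 1))) ub.
near=> n.
have : `|a - complex.Re (u n)| < complex.Re e / 2.
  by rewrite -[u n]mul1r; near: n.
have : `|b - complex.Im (u n)| < complex.Re e / 2.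
  have -> : complex.Im (u n) = complex.Re ((- 'i)%C * u n).
    by case: (u n) => c d /=; lra.
  by near: n.
case: (u n) => c d /= H1 H2; rewrite ltcR.
have := normr_ge0 (a - c); have := normr_ge0 (b - d) => n1 n2.
apply: (@le_lt_trans _ _ (`|a - c| + `|b - d|)); last lra.
rewrite -[leRHS]ger0_norm ?addr_ge0// -sqrtr_sqr ler_wsqrtr//.
by rewrite -[(a - c) ^+ 2]real_normK ?num_real// -[(b - d) ^+ 2]real_normK ?num_real//; nra.
Unshelve. all: by end_near. Qed.

(** For each [k], the real parts of the terms multiplied by [k] form an absolutely convergent
    series, dominated by [abs k * D]; [real_part_is_cvg] then gives convergence in [K]. *)
Lemma abs_summable_cvg (P : pred nat) (u : K ^nat) (d : R ^nat) D :
  (forall n, P n -> abs (u n) <= d n) -> (forall n, 0 <= d n) ->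
  (forall n, \sum_(0 <= i < n) d i <= D) ->
  (fun n => \sum_(0 <= i < n | P i) u i) @ \oo -->
    (\big[+%R/0]_(0 <= i <oo | P i) u i : K^o).
Proof.
move=> ud d0 dD; apply: real_part_is_cvg => k.
pose v n := if P n then re (k * u n) else 0.
have -> : (fun n => re (k * \sum_(0 <= i < n | P i) u i)) = series v.
  apply/funext => n; rewrite mulr_sumr real_part_sum /series /= /v.
  by rewrite big_mkcond.
apply: normed_cvg; apply: nondecreasing_is_cvgn.
  by apply: nondecreasing_series => n _ _; exact: normr_ge0.
exists (abs k * D) => _ [n _ <-].
apply: le_trans (ler_wpM2l (rnorm_ge0 h _) (dD n)).
rewrite /series /= mulr_sumr; apply: ler_sum => i _.
rewrite /v; case: ifPn => [Pi|_].
  apply: le_trans (real_part_normr_le _) _; rewrite rnormM.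
  by apply: ler_wpM2l; [exact: rnorm_ge0|exact: ud].
by rewrite normr0 mulr_ge0// rnorm_ge0.
Qed.

End scalar_field.

(** * Support functionals *)

Section functionals.
Context {R : realType} {K : numFieldType} (h : RorC R K) {V : normedModType K}.
Implicit Types (u v x y : V) (F : V -> K^o).

Local Notation re := (real_part h).
Local Notation abs z := (rnorm h (z : K^o)).
Local Notation nrm := (@rnorm R K h V).

Lemma rnorm_sublinear : sublinear h nrm.
Proof.
split=> [u v|r v r0]; first exact: rnormD.
by rewrite rnormZ normr_of_real of_realK ger0_norm.
Qed.

Lemma linear_real_part F : linear F -> rlinear h (re \o F).
Proof. by move=> lF r u v; rewrite /= lF real_partD; congr +%R; exact: real_partZ. Qed.

Lemma linear_fun0 F : linear F -> F 0 = 0.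
Proof. by move=> lF; have := lF (- 1) 0 0; rewrite !scaleN1r oppr0 addr0 addNr. Qed.

Lemma linear_scale F k v : linear F -> F (k *: v) = k * F v.
Proof. by move=> lF; rewrite -[_ *: _]addr0 lF linear_fun0// addr0. Qed.

Lemma linear_add F u v : linear F -> F (u + v) = F u + F v.
Proof. by move=> lF; have := lF 1 u v; rewrite !scale1r. Qed.

Lemma linear_sub F u v : linear F -> F (u - v) = F u - F v.
Proof. by move=> lF; rewrite linear_add// -scaleN1r linear_scale// mulN1r. Qed.

(** Over the complex numbers, [F v] is [f v - i f (i v)]. *)
Lemma linear_of_real_part (f : V -> R) : rlinear h f ->
  exists F, linear F /\ forall v, re (F v) = f v.
Proof.
case: K / h V f => W f fl; first by exists f.
exists (fun w : W => (f w +i* (- f ('i%C *: w)))%C : R[i]^o); split=> // -[a b] u w.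
have fi (z : W) : f ('i%C *: ('i%C *: z)) = - f z.
  by rewrite scalerA -expr2 sqr_i scaleN1r (rlinearN _ fl).
have fM (z : W) : f ((a +i* b)%C *: z) = a * f z + b * f ('i%C *: z).
  have -> : (a +i* b)%C = a%:C%C + b%:C%C * 'i%C.
    by apply/eqP; rewrite eq_complex /=; apply/andP; split; apply/eqP; ring.
  by rewrite scalerDl -scalerA fl (rlinearZ _ _ fl).
have fiM : f ('i%C *: ((a +i* b)%C *: u)) = a * f ('i%C *: u) - b * f u.
  by rewrite scalerA mulrC -scalerA (fM ('i%C *: u)) fi mulrN.
apply/eqP; rewrite eq_complex /= scalerDr !(rlinearD _ _ fl).
apply/andP; split; apply/eqP.
  by apply: (etrans (congr1 (+%R^~ (f w)) (fM u))); ring.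
apply: (etrans (congr1 (fun r => - (r + f ('i%C *: w))) fiM)); rewrite /=; ring.
Qed.

(** Multiplying [v] by a phase makes [F v] real and nonnegative without changing the norm of [v]. *)
Lemma linear_rnorm_le F c : linear F -> (forall v, re (F v) <= c * rnorm h v) ->
  forall v, abs (F v) <= c * rnorm h v.
Proof.
move=> lF Fle v; have [u [u1 uE]] := exists_phase h (F v).
rewrite -[leLHS](of_realK h) -uE -linear_scale//.
by apply: le_trans (Fle _) _; rewrite rnormZ -/(abs u) u1 mul1r.
Qed.

Lemma dual_norm_le1 F : linear F -> dual_norm h F = 1 ->
  forall v, abs (F v) <= rnorm h v.
Proof.
move=> lF F1 v; have [->|v0] := eqVneq v 0.
  by rewrite linear_fun0// !rnorm0.
have v1 : 0 < rnorm h v.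
  by rewrite lt_neqAle rnorm_ge0 andbT eq_sym; apply: contra_neq v0 => /rnorm0_eq0.
(* [sup] takes the default value 0 where no supremum exists, so the value 1 guarantees a genuine
   one. *)
have hs : has_sup [set abs (F v) | v in [set v : V | `|v| <= 1]].
  apply: contrapT => /sup_out; rewrite -/(dual_norm h F) F1 => /eqP.
  by rewrite oner_eq0.
have := sup_upper_bound hs; rewrite -/(dual_norm h F) F1.
move=> /(_ (abs (F (of_real h (rnorm h v)^-1 *: v)))).
rewrite linear_scale// rnormM rnorm_of_real ger0_norm ?invr_ge0 ?rnorm_ge0//.
rewrite ler_pdivrMl// mulr1; apply.
exists (of_real h (rnorm h v)^-1 *: v) => /=; last first.
  by rewrite linear_scale// rnormM rnorm_of_real ger0_norm ?invr_ge0 ?rnorm_ge0.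
rewrite normrZ normr_of_real -(rnormE h v) -of_realM ger0_norm ?invr_ge0 ?rnorm_ge0//.
by rewrite mulVf ?gt_eqF// of_real1.
Qed.

(** Trades continuity and the dual norm for a pointwise bound. Contractivity gives continuity, the
    vector [x / |x|] shows that the norm is 1, and [re (F x) >= abs (F x)] makes [F x] real. *)
Lemma support_functionalsP x F : x != 0 -> support_functionals h x F <->
  [/\ linear F, (forall v, abs (F v) <= rnorm h v) & re (F x) = rnorm h x].
Proof.
move=> x0; split=> [[lF _ F1 Fx]|[lF F1 Fx]].
  by split=> //; [exact: dual_norm_le1|rewrite Fx].
have FxE : F x = `|x|.
  rewrite -(rnormE h x) (@real_part_eq_rnorm _ _ h (F x)); last by rewrite Fx.
  by congr of_real; apply/le_anti; rewrite F1 -Fx real_part_le.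
have x1 : 0 < rnorm h x.
  by rewrite lt_neqAle rnorm_ge0 andbT eq_sym; apply: contra_neq x0 => /rnorm0_eq0.
split=> //.
- move=> u; apply/cvgrPdist_lt => e e0.
  near=> v; rewrite -linear_sub//.
  apply: (@le_lt_trans _ _ `|u - v|); first by rewrite (ler_rnorm h).
  by near: v; apply: cvgr_dist_lt.
- have N1 : 1 = abs (F (of_real h (rnorm h x)^-1 *: x)).
    rewrite linear_scale// FxE -(rnormE h x) -of_realM mulVf ?gt_eqF//.
    by rewrite rnorm_of_real normr1.
  apply/le_anti/andP; split.
    apply: ge_sup.
      by exists (abs (F 0)), 0 => //=; rewrite normr0.
    move=> _ [v /= v1 <-]; apply: le_trans (F1 v) _.
    by rewrite -(ler_of_real h) of_real1 rnormE.
  rewrite [leLHS]N1; apply: ub_le_sup.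
    exists 1 => _ [v /= v1 <-]; apply: le_trans (F1 v) _.
    by rewrite -(ler_of_real h) of_real1 rnormE.
  exists (of_real h (rnorm h x)^-1 *: x) => //=.
  rewrite normrZ normr_of_real -(rnormE h x) -of_realM ger0_norm ?invr_ge0 ?rnorm_ge0//.
  by rewrite mulVf ?gt_eqF// of_real1.
Unshelve. all: by end_near. Qed.

(** [face_fun h nrm x v] is the one-sided derivative of the norm at [x] in the direction [v], where
    [r] is the inverse of the increment. *)
Lemma support_le_face_fun x F v : x != 0 -> support_functionals h x F ->
  re (F v) <= face_fun h nrm x v.
Proof.
move=> x0 /(support_functionalsP _ x0)[lF F1 Fx]; apply: le_face_fun => r r0.
rewrite lerBrDr -Fx -(rlinearZ r x (linear_real_part lF)) -(rlinearD _ _ (linear_real_part lF)).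
exact: le_trans (real_part_le _ _) (F1 _).
Qed.

(** A facial linear functional below the derivative of the norm is extended to a [K]-linear one. If
    it is a proper combination of elements of J(x), these lie below the derivative, so being facial
    puts their real parts below [f]. *)
Lemma extreme_support x v : x != 0 ->
  exists F, extreme_points (support_functionals h x) F /\
    re (F v) = face_fun h nrm x v.
Proof.
move=> x0; have sr := rnorm_sublinear.
have sf : sublinear h (face_fun h nrm x) by exact: face_fun_sublinear.
have [f [fl fq [_ _ fF] [fv _]]] := extreme_rlinear_below v sf.
have [F [lF FE]] := linear_of_real_part fl.
have JF : support_functionals h x F.
  apply/(support_functionalsP _ x0).
  have Fle u : re (F u) <= rnorm h u.
    by rewrite FE; apply: le_trans (fq u) _; exact: face_funW.
  split=> //.
    move=> u; rewrite -[leRHS]mul1r; apply: linear_rnorm_le => // w.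
    by rewrite mul1r.
  apply/le_anti; rewrite Fle/= FE.
  by have := le_trans (fq (- x)) (face_funN _ sr); rewrite (rlinearN _ fl) lerN2.
exists F; split; last by rewrite FE.
have key (g1 g2 : V -> K^o) (s : R) : support_functionals h x g1 ->
    support_functionals h x g2 -> 0 < s < 1 ->
    F = (of_real h s : K) *: g1 + (1 - of_real h s) *: g2 -> g1 = F.
  move=> J1 J2 s01 FD.
  have [[lg1 _ _ _] [lg2 _ _ _]] := (J1, J2).
  have le1 u : re (g1 u) <= f u.
    apply: (fF (re \o g1) (re \o g2) s) => //.
    - exact: linear_real_part.
    - exact: linear_real_part.
    - by move=> w; exact: support_le_face_fun.
    - by move=> w; exact: support_le_face_fun.
    - move=> w; rewrite -FE FD /= real_partD [X in _ <= X + _]real_partZ.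
      by rewrite -(of_real1 h) -of_realN -of_realD [X in _ <= _ + X]real_partZ.
  (* A real-linear functional below another equals it; testing at all multiples [k *: u] recovers
     the full scalar values. *)
  apply/funext => u; apply: (real_part_inj (h := h)) => k.
  rewrite -!linear_scale// FE; apply/le_anti; rewrite le1/=.
  have := le1 (- (k *: u)); rewrite (rlinearN _ fl).
  by have /= -> := rlinearN (k *: u) (linear_real_part lg1); rewrite lerN2.
split=> // g1 g2 t J1 J2 /andP[t0 t1] FD.
have tE : of_real h (re t) = t by rewrite real_partK// ltW.
have s01 : 0 < re t < 1.
  by rewrite -!(ltr_of_real h) of_real0 of_real1 tE t0.
split.
  by apply: (key g1 g2 (re t)) => //; rewrite tE.
apply: (key g2 g1 (1 - re t)) => //; first lra.
by rewrite of_realD of_realN of_real1 tE FD [RHS]addrC; congr (_ *: _ + _); ring.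
Qed.

Lemma extreme_support_ge x v : x != 0 ->
  exists F, extreme_points (support_functionals h x) F /\
    forall G, support_functionals h x G -> re (G v) <= re (F v).
Proof.
move=> x0; have [F [eF Fv]] := extreme_support v x0; exists F; split=> // G JG.
by rewrite Fv; exact: support_le_face_fun.
Qed.

(** Some extreme [F] realizes the derivative of the norm, so a term [|v + r x| - r |x|] of the
    infimum is negative. Then [r] is not 0, and [r^-1] is the required step. *)
Lemma support_lt0_descent x v : x != 0 ->
  (forall F, extreme_points (support_functionals h x) F -> re (F v) < 0) ->
  exists2 t : R, 0 < t & rnorm h (x + of_real h t *: v) < rnorm h x.
Proof.
move=> x0 Flt; have [F [/Flt + Fv]] := extreme_support v x0; rewrite Fv.
move=> /inf_lt -/(_ (ex_intro _ _ (ex_intro2 _ _ 0 _ erefl)))[].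
  by rewrite /= in_itv/= lexx.
move=> _ [r + <-]; rewrite /= in_itv/= andbT le_eqVlt => /predU1P[<-|r0].
  by rewrite of_real0 scale0r addr0 mul0r subr0 ltNge rnorm_ge0.
move=> hr; exists r^-1; rewrite ?invr_gt0//.
have -> : x + of_real h r^-1 *: v = of_real h r^-1 *: (v + of_real h r *: x).
  by rewrite scalerDr scalerA -of_realM mulVf ?gt_eqF// of_real1 scale1r addrC.
by rewrite (rnorm_sublinear).2 ?invr_ge0 ?(ltW r0)// ltr_pdivrMl//; lra.
Qed.

(* James: the functional is dominated by the quotient seminorm modulo [K y]. *)
Theorem birkhoff_james_functional x y : birkhoff_james x y ->
  exists F, [/\ linear F, (forall v, abs (F v) <= rnorm h v),
    re (F x) = rnorm h x & F y = 0].
Proof.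
move=> xy; pose q v := inf (range (fun k : K => rnorm h (v + k *: y))).
have qle k v : q v <= rnorm h (v + k *: y).
  by apply: ge_inf; [exists 0 => _ [l _ <-]; exact: rnorm_ge0|exists k].
have leq v c : (forall k, c <= rnorm h (v + k *: y)) -> c <= q v.
  move=> cv; apply: lb_le_inf; first by exists (rnorm h (v + 0 *: y)), 0.
  by move=> _ [k _ <-].
have qW v : q v <= rnorm h v by have := qle 0 v; rewrite scale0r addr0.
have sq : sublinear h q.
  apply: sublinearP => [u v||r v r0].
  - rewrite -lerBlDr; apply/leq => k; rewrite lerBlDl -lerBlDr; apply/leq => l.
    rewrite lerBlDr; apply: le_trans (qle (l + k) _) _.
    by rewrite [u + v]addrC scalerDl addrACA; exact: rnormD.
  - apply/le_anti; rewrite leq ?andbT => [|k]; last exact: rnorm_ge0.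
    by rewrite (le_trans (qW 0))// rnorm0.
  - rewrite -ler_pdivrMl//; apply/leq => k; rewrite ler_pdivrMl//.
    apply: le_trans (qle (of_real h r * k) _) _.
    by rewrite -scalerA -scalerDr rnorm_sublinear.2// ltW.
have [f [fl fq _ [fx _]]] := extreme_rlinear_below x sq.
have [F [lF FE]] := linear_of_real_part fl.
exists F; split=> //.
- move=> v; rewrite -[leRHS]mul1r; apply: linear_rnorm_le => // w.
  by rewrite FE mul1r (le_trans (fq w)).
(* Orthogonality says exactly that passing to the quotient does not decrease the norm of [x]. *)
- rewrite FE fx; apply/le_anti; rewrite qW/=; apply/leq => k.
  by rewrite -ler_rnorm.
- apply: (real_part_inj (h := h)) => k; rewrite mulr0 real_part0.
  (* The quotient seminorm vanishes on multiples of [y], and a linear functional that is nonpositive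
     on a subspace is zero there. *)
  have fk l : f (l *: y) <= 0.
    apply: le_trans (fq _) _; apply: le_trans (qle (- l) _) _.
    by rewrite -scalerDl subrr scale0r rnorm0.
  rewrite -linear_scale// FE; apply/le_anti; rewrite fk/=.
  by have := fk (- k); rewrite scaleNr (rlinearN _ fl) oppr_le0.
Qed.

End functionals.

(** * Closed convex hulls of scalars *)

Section separation.
Context {R : realType} {K : numFieldType} (h : RorC R K).
Implicit Types (A : set K^o) (k : K).

Local Notation re := (real_part h).
Local Notation abs z := (rnorm h (z : K^o)).

Lemma i01_of_real (t : {i01 K}) :
  exists2 s : R, 0 <= s <= 1 & t%:num = of_real h s.
Proof.
have t0 : 0 <= t%:num by exact: ge0.
have t1 : t%:num <= 1 by exact: le1.
exists (re t%:num); last by rewrite real_partK.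
by rewrite -!(ler_of_real h) of_real0 of_real1 real_partK// t0.
Qed.

Lemma convE (z w : convex_lmodType K^o) (t : {i01 K}) :
  conv t z w = t%:num * z + (1 - t%:num) * w :> K.
Proof. by []. Qed.

Lemma convex_half_space k (c : R) :
  @convex_set K K^o [set z | re (k * z) <= c].
Proof.
move=> z w t /set_mem /= zc /set_mem /= wc; apply/mem_set => /=.
have [s s01 tE] := i01_of_real t.
rewrite convE tE -(of_real1 h) -of_realN -of_realD.
rewrite mulrDr !(mulrCA k) real_partD.
have := real_partZ h s (k * z); have := real_partZ h (1 - s) (k * w).
by move=> -> ->; nra.
Qed.

Lemma convex_rnorm_ball (c : R) :
  @convex_set K K^o [set z | abs z <= c].
Proof.
move=> z w t /set_mem /= zc /set_mem /= wc; apply/mem_set => /=.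
have [s /andP[s0 s1] tE] := i01_of_real t.
rewrite convE tE -(of_real1 h) -of_realN -of_realD.
apply: le_trans (rnormD _ _ _) _; rewrite !rnormM !rnorm_of_real.
by rewrite !ger0_norm ?subr_ge0//; nra.
Qed.

(** Otherwise the half-space [re (k * z) <= - d] contains the convex hull, yet it misses the ball of
    radius [d / (abs k + 1)] about 0. The added 1 covers [k = 0]. *)
Lemma closed_conv0_real_part A : closed_conv A 0 ->
  forall k (d : R), 0 < d -> exists2 a, A a & - d < re (k * a).
Proof.
move=> A0 k d d0; apply: contrapT => Ad.
have sA : smallest (@convex_set K K^o) A `<=` [set z | re (k * z) <= - d].
  apply: smallest_sub; first exact: convex_half_space.
  by move=> a Aa /=; rewrite leNgt; apply/negP => da; apply: Ad; exists a.
have k1 : 0 < abs k + 1 by have := rnorm_ge0 h (k : K^o); lra.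
have e0 : 0 < of_real h (d / (abs k + 1)).
  by rewrite -(of_real0 h) ltr_of_real divr_gt0.
have [z [/sA /= zd]] := A0 _ (nbhsx_ballx 0 _ e0).
rewrite -ball_normE /= sub0r normrN -(rnormE h) ltr_of_real ltr_pdivlMr// => zk.
have := real_part_normr_le h (k * z); rewrite rnormM.
have := rnorm_ge0 h (z : K^o); have := ler_norm (- re (k * z)); rewrite normrN.
by nra.
Qed.

(* A point of [C := conv A] of almost minimal norm [r], rotated onto the positive
   axis, cannot be brought closer to [0] by moving a fraction [s] towards [a]. *)
Lemma closed_conv0P A D : (forall a, A a -> abs a <= D) ->
  closed_conv A 0 <->
  forall k (d : R), 0 < d -> exists2 a, A a & - d < re (k * a).
Proof.
move=> AD; split; first exact: closed_conv0_real_part.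
move=> Ak; apply: contrapT => A0.
pose C := smallest (@convex_set K K^o) A.
have CA : A `<=` C by exact: sub_smallest.
have CD c : C c -> abs c <= D.
  by move=> Cc; apply: (Cc [set z | abs z <= D]); split=> //; exact: convex_rnorm_ball.
have [e e0 eC] : exists2 e : R, 0 < e & forall c, C c -> e <= abs c.
  apply: contrapT => eC; apply: A0 => B /nbhs_ballP[e /= e0 eB].
  apply: contrapT => CB; apply: eC; exists (re e).
    by rewrite -(ltr_of_real h) of_real0 real_partK// ltW.
  move=> c Cc; rewrite leNgt; apply/negP => ce; apply: CB; exists c; split=> //.
  apply: eB; rewrite -ball_normE /= sub0r normrN -(rnormE h).
  by rewrite -[ltRHS](real_partK h) ?ltr_of_real// ltW.
have convC a c (s : R) : C a -> C c -> 0 <= s <= 1 -> C (c + of_real h s * (a - c)).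
  move=> Ca Cc s01 B [cB AB].
  have s0 : 0 <= of_real h s by rewrite -(of_real0 h) ler_of_real; case/andP: s01.
  have s1 : of_real h s <= 1 by rewrite -(of_real1 h) ler_of_real; case/andP: s01.
  have := cB a c (Itv01 s0 s1) (mem_set (Ca B (conj cB AB))) (mem_set (Cc B (conj cB AB))).
  move=> /set_mem; rewrite convE /=; congr (B _); ring.
have [a0 Aa0 _] := Ak 0 1 ltr01.
pose N := [set abs c ^+ 2 | c in C].
have hN : has_inf N.
  split; first by exists (abs a0 ^+ 2), a0 => //; exact: CA.
  by exists 0 => _ [c _ <-]; exact: sqr_ge0.
pose m : R := inf N.
have mN c : C c -> m <= abs c ^+ 2.
  by move=> Cc; apply: ge_inf; [exact: hN.2|exists c].
have m0 : 0 < m.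
  apply: (@lt_le_trans _ _ (e ^+ 2)); first by rewrite exprn_gt0.
  apply: lb_le_inf; first exact: hN.1.
  by move=> _ [c Cc <-]; have := eC _ Cc; nra.
have D0 : 0 <= D by apply: le_trans (AD _ Aa0); exact: rnorm_ge0.
(* [M] collects the coefficients of the errors of order [s ^+ 2] in the new squared norm. With
   [s = m / M] they total at most [s * m], less than the first-order gain [2 * s * m]. *)
pose M : R := m + 1 + 2 * D + D ^+ 2.
have M0 : 0 < M by rewrite /M; nra.
pose s : R := m / M.
have s0 : 0 < s by exact: divr_gt0.
have s1 : s <= 1 by rewrite ler_pdivrMr// mul1r /M; nra.
have sM : s * M = m by rewrite divfK// gt_eqF.
have [_ [c Cc <-] cs] := inf_adherent (exprn_gt0 2 s0) hN; rewrite -/m in cs.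
have [u [u1 uc]] := exists_phase h c.
(* The phase [u] rotates [c] onto the positive axis, and this [a] satisfies [re (u * a) < s]: the
   cross term is of order [s ^+ 2]. *)
have [a Aa ad] := Ak (- u) s s0.
have s01 : 0 <= s <= 1 by rewrite s1 ltW.
have := mN _ (convC a c s (CA _ Aa) Cc s01).
have -> : abs (c + of_real h s * (a - c)) =
    abs (of_real h ((1 - s) * abs c) + of_real h s * (u * a)).
  have -> : of_real h ((1 - s) * abs c) + of_real h s * (u * a) =
      u * (c + of_real h s * (a - c)).
    rewrite of_realM of_realD of_realN of_real1 -uc; ring.
  by rewrite rnormM u1 mul1r.
rewrite rnorm_sqrD rnormM (real_partZ h s (u * a)) rnormM u1 mul1r.
rewrite rnorm_of_real (ger0_norm (ltW s0)).
have := AD _ Aa; have := CD _ Cc; have := rnorm_ge0 h (a : K^o); have := rnorm_ge0 h (c : K^o).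
move: ad; rewrite mulNr real_partN => ad.
set r := abs c in cs *; set b := abs a; set q := re (u * a) in ad *.
move=> r0 b0 rD bD H.
have h1 : (1 - s) * r * (s * q) <= s ^+ 2 * D.
  have qs : q < s by lra.
  have rs : 0 <= (1 - s) * r * s.
    apply: mulr_ge0; last exact: ltW.
    by apply: mulr_ge0 => //; rewrite subr_ge0.
  have rs' : (1 - s) * r <= D by nra.
  have : (1 - s) * r * s * q <= (1 - s) * r * s * s by apply: ler_wpM2l => //; exact: ltW.
  have : (1 - s) * r * s * s <= D * s * s.
    by do 2!(apply: ler_wpM2r; first exact: ltW).
  by rewrite expr2; lra.
have h2 : ((1 - s) * r) ^+ 2 <= (1 - s) ^+ 2 * (m + s ^+ 2).
  by rewrite exprMn ler_wpM2l ?sqr_ge0// ltW.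
have h3 : (s * b) ^+ 2 <= s ^+ 2 * D ^+ 2.
  by rewrite exprMn ler_wpM2l ?sqr_ge0//; nra.
have h4 : 2 * s * m <= s * (s * M) - s ^+ 2 * (1 - (1 - s) ^+ 2).
  rewrite /M; lra.
have h5 : 0 <= s ^+ 2 * (1 - (1 - s) ^+ 2).
  by rewrite mulr_ge0 ?sqr_ge0//; nra.
by rewrite sM in h4; nra.
Qed.

End separation.

(** * Direct sums *)

Section powR_inequalities.
Context {R : realType}.
Implicit Types a b c d p r s t : R.

Lemma powR_tangent p a b : 1 <= p -> 0 <= a -> 0 <= b ->
  p * (b `^ (p - 1) * (a - b)) <= a `^ p - b `^ p.
Proof.
rewrite le_eqVlt => /predU1P[<-|p1] a0 b0.
  by rewrite subrr powRr0 !powRr1//; lra.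
have p0 : 0 < p by lra.
have q0 : 0 < p / (p - 1) by rewrite divr_gt0//; lra.
have pq : p^-1 + (p / (p - 1))^-1 = 1.
  by field; rewrite !gt_eqF; lra.
have := conjugate_powR a0 (powR_ge0 b (p - 1)) p0 q0 pq.
have -> : (b `^ (p - 1)) `^ (p / (p - 1)) = b `^ p.
  by rewrite -powRrM; congr powR; field; rewrite ?gt_eqF; lra.
rewrite -(ler_pM2l p0) mulrDr invf_div.
have -> : p * (a `^ p / p) = a `^ p by rewrite mulrC divfK ?gt_eqF.
have -> : p * (b `^ p * ((p - 1) / p)) = (p - 1) * b `^ p by field; rewrite ?gt_eqF; lra.
rewrite -(mulr_powRB1 b0 p0); lra.
Qed.

Lemma powRB1_mul_le p a b : 1 <= p -> 0 <= a -> 0 <= b ->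
  a `^ (p - 1) * b <= a `^ p + b `^ p.
Proof.
move=> p1 a0 b0; have p0 : 0 < p by lra.
have [ba|ab] := leP b a.
  rewrite -(mulr_powRB1 a0 p0) [a * _]mulrC.
  apply: (@le_trans _ _ (a `^ (p - 1) * a)); first exact: ler_wpM2l (powR_ge0 _ _) _ _ ba.
  by rewrite lerDl powR_ge0.
rewrite -(mulr_powRB1 b0 p0) [b * _]mulrC.
apply: (@le_trans _ _ (b `^ (p - 1) * b)); last by rewrite lerDr powR_ge0.
apply: ler_wpM2r => //; apply: ge0_ler_powR; rewrite ?nnegrE ?(ltW ab)//; lra.
Qed.

(** For [a > 0] the power is differentiable at [a]; for [a = 0] the expression splits as [t]^ r * s
    [^ r], which uses [0 <= s]. *)
Lemma powR_affine_cvg a s r : 0 <= a -> 0 <= r -> (a = 0 -> 0 <= s) ->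
  (a + t * s) `^ r @[t --> 0^'+] --> a `^ r.
Proof.
move=> a0 r0 as0.
have [->|rn0] := eqVneq r 0.
  by rewrite powRr0; under eq_fun do rewrite powRr0; exact: cvg_cst.
have {r0 rn0} r0 : 0 < r by rewrite lt_neqAle eq_sym rn0.
move: a0; rewrite le_eqVlt => /predU1P[a0|a0].
  rewrite -a0 powR0 ?gt_eqF//.
  have H : (t `^ r * s `^ r) @[t --> (0 : R)^'+] --> 0 * s `^ r.
    by apply: cvgM; [exact: powR_cvg0|exact: cvg_cst].
  rewrite mul0r in H; apply: cvg_trans H; apply: near_eq_cvg.
  near=> t; rewrite add0r powRM//; exact: as0.
have ca : b `^ r @[b --> a] --> a `^ r.
  suff : {for a, continuous (fun b : R => b `^ r)} by [].
  apply: differentiable_continuous; apply/derivable1_diffP.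
  by apply: derivable_powR; rewrite in_itv/= a0.
apply: (@cvg_comp _ _ _ (fun t : R => a + t * s) (fun b : R => b `^ r) _ (nbhs a)) => //.
have : a + t * s @[t --> (0 : R)^'+] --> a + 0 * s.
  apply: cvgD; first exact: cvg_cst.
  by apply: cvgM; [apply: cvg_at_right_filter; exact: cvg_id|exact: cvg_cst].
by rewrite mul0r addr0.
Unshelve. all: by end_near. Qed.

(** Lets [t] tend to 0 from the right in difference quotients of powers of the norm. *)
Lemma powR_affine_ge a s r c d : 0 <= a -> 0 <= r -> (a = 0 -> 0 <= s) ->
  (forall t, 0 < t < 1 -> c <= d * (a + t * s) `^ r) -> c <= d * a `^ r.
Proof.
move=> a0 r0 as0 cd.
have /(cvgM (cvg_cst d)) := powR_affine_cvg a0 r0 as0; move=> H.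
rewrite -(cvg_lim _ H)//; apply: limr_ge; first by apply: cvgP H.
near=> t; apply: cd; apply/andP; split; near: t.
  exact: nbhs_right_gt.
exact: nbhs_right_lt.
Unshelve. all: by end_near. Qed.

End powR_inequalities.

Section direct_sum_norm.
Context {R : realType} {K : numFieldType} (h : RorC R K) {p : R}.
Context (hp : p = 0 \/ 1 <= p) (X : nat -> normedModType K).

Local Notation Z := (direct_sum h hp X).
Implicit Types x y z : Z.

Lemma dsum_normE z : rnorm h z = lp_norm p (fun n => rnorm h (z n)).
Proof. exact: of_realK. Qed.

Lemma dsum_norm_coord z n : rnorm h (z n) <= rnorm h z.
Proof.
rewrite dsum_normE; apply: (lp_norm_ge hp (a := fun n => rnorm h (z n)) n); last exact: dsum_memP.
by move=> m; exact: rnorm_ge0.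
Qed.

Lemma dsum_powR_series_le z n : p != 0 ->
  \sum_(0 <= i < n) rnorm h (z i) `^ p <= rnorm h z `^ p.
Proof.
by move=> p0; rewrite dsum_normE; exact: series_le_lp_norm (dsum_memP z).
Qed.

Lemma dsum_powR_series_cvg z : p != 0 ->
  (fun n => \sum_(0 <= i < n) rnorm h (z i) `^ p) @ \oo --> rnorm h z `^ p.
Proof.
move=> p0; have := dsum_memP z; rewrite dsum_normE /lp_mem /lp_norm (negbTE p0) => cz.
rewrite -powRrM mulVf// powRr1; first exact: cz.
apply: limr_ge => //; near=> n; apply: sumr_ge0 => i _; exact: powR_ge0.
Unshelve. all: by end_near. Qed.

Lemma dsum_norm_le z M : p != 0 -> 0 <= M ->
  (forall n, \sum_(0 <= i < n) rnorm h (z i) `^ p <= M `^ p) -> rnorm h z <= M.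
Proof.
by move=> p0 M0 zM; rewrite dsum_normE; exact: (lp_bounded hp p0 M0 zM).2.
Qed.

End direct_sum_norm.

Lemma sum_single (V : nmodType) (n k : nat) (u : nat -> V) :
  (forall m, m != n -> u m = 0) ->
  \sum_(0 <= m < k) u m = if (n < k)%N then u n else 0.
Proof.
move=> u0; elim: k => [|k IH]; first by rewrite big_nil.
rewrite big_nat_recr//= IH [in RHS]ltnS [in RHS]leq_eqVlt; have [->|kn] := eqVneq n k.
  by rewrite ltnn add0r.
by rewrite (u0 k) ?addr0// eq_sym.
Qed.

(** * Norming functionals on l^p sums and their coordinates *)

Section direct_sum_dual.
Context {R : realType} {K : numFieldType} (h : RorC R K) {p : R}.
Context (hp : p = 0 \/ 1 <= p) (X : nat -> normedModType K) (p1 : 1 <= p).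

Local Notation Z := (direct_sum h hp X).
Local Notation re := (real_part h).
Local Notation abs z := (rnorm h (z : K^o)).
Implicit Types x y z : Z.

Let p_neq0 : p != 0. Proof. by rewrite gt_eqF// (lt_le_trans ltr01). Qed.

(** The coordinate spaces depend on the index, so [v] has to be cast along a proof of [n = m]. *)
Definition single_seq n (v : X n) m : X m :=
  if n =P m is ReflectT e then ecast i (X i) e v else 0.

Lemma single_seqE n (v : X n) : single_seq v n = v.
Proof. by rewrite /single_seq; case: eqP => // e; rewrite eq_axiomK. Qed.

Lemma single_seq_neq n (v : X n) m : m != n -> single_seq v m = 0.
Proof. by move=> mn; rewrite /single_seq; case: eqP => // e; rewrite e eqxx in mn. Qed.

Lemma single_seq_mem n (v : X n) : lp_mem p (fun m => rnorm h (single_seq v m)).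
Proof.
apply: (lp_bounded hp p_neq0 (rnorm_ge0 h v) _).1 => k.
rewrite /series /= (sum_single _ (n := n)) => [|m mn].
  by rewrite single_seqE; case: ifP => // _; exact: powR_ge0.
by rewrite single_seq_neq// rnorm0 powR0.
Qed.

Definition dsum_single n (v : X n) : Z := DirectSum hp (single_seq_mem v).

Lemma dsum_singleE n (v : X n) : dsum_single v n = v.
Proof. exact: single_seqE. Qed.

Lemma dsum_single_neq n (v : X n) m : m != n -> dsum_single v m = 0.
Proof. exact: single_seq_neq. Qed.

Lemma dsum_single_linear n : linear (@dsum_single n).
Proof.
move=> k u v; apply: direct_sum_eq => m.
have -> : (k *: dsum_single u + dsum_single v) m =
  k *: dsum_single u m + dsum_single v m by [].
have [->|mn] := eqVneq m n; first by rewrite !dsum_singleE.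
by rewrite !dsum_single_neq// scaler0 addr0.
Qed.

Lemma dsum_sum_coord (F : nat -> Z) k m :
  (\sum_(0 <= n < k) F n) m = \sum_(0 <= n < k) F n m.
Proof. by apply: (big_morph (fun z : Z => z m)). Qed.

(** The p-th power of the tail norm is at most [|z|^p] minus a partial sum of its series. This
    density of finitely supported sequences lets a bounded functional be summed over coordinates. *)
Lemma dsum_tail_norm_cvg z :
  (fun k => rnorm h (z - \sum_(0 <= n < k) dsum_single (z n))) @ \oo --> (0 : R).
Proof.
have cz := dsum_powR_series_cvg (z := z) p_neq0.
apply/cvgrPdist_le => e e0; near=> k.
rewrite sub0r normrN ger0_norm ?rnorm_ge0//.
set r := z - _.
have rE m : r m = if (m < k)%N then 0 else z m.
  have -> : r m = z m - (\sum_(0 <= n < k) dsum_single (z n)) m by [].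
  rewrite dsum_sum_coord (sum_single _ (n := m)) => [|n nm].
    by case: ifP => _; rewrite ?dsum_singleE ?subrr ?subr0.
  by rewrite dsum_single_neq// eq_sym.
clearbody r.
apply: dsum_norm_le => // [|j]; first exact: ltW.
apply: (@le_trans _ _ (rnorm h z `^ p - \sum_(0 <= i < k) rnorm h (z i) `^ p)); last first.
  apply: le_trans (ler_norm _) _; near: k.
  by move/cvgrPdist_le : cz; apply; rewrite powR_gt0.
rewrite lerBrDr addrC.
apply: le_trans (dsum_powR_series_le z (maxn k j) p_neq0).
rewrite [leRHS](big_cat_nat (n := k)) ?leq_maxl// lerD2l.
have [jk|kj] := leqP j k.
  rewrite [leLHS]big_nat_cond [leLHS]big1 => [|i /andP[/andP[_ ij] _]]; last first.
    by rewrite rE (leq_trans ij jk) rnorm0 powR0.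
  by apply: sumr_ge0 => i _; exact: powR_ge0.
rewrite [leLHS](big_cat_nat (n := k)) ?(ltnW kj)//=.
rewrite [X in X + _]big_nat_cond [X in X + _]big1 ?add0r => [|i /andP[/andP[_ ij] _]]; last first.
  by rewrite rE ij rnorm0 powR0.
rewrite big_nat_cond [leRHS]big_nat_cond; apply: ler_sum => i /andP[/andP[ki _] _].
by rewrite rE ltnNge ki.
Unshelve. all: by end_near. Qed.

(** The partial sums for the two vectors differ by a constant once they include index [n]. *)
Lemma dsum_single_norm x n (w : X n) :
  rnorm h (x + dsum_single w) `^ p =
  rnorm h x `^ p + (rnorm h (x n + w) `^ p - rnorm h (x n) `^ p).
Proof.
set x' := x + _.
have x'E m : x' m = x m + dsum_single w m by [].
apply/eqP; rewrite [eqbRHS]addrC -subr_eq; apply/eqP.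
have H : (fun k => \sum_(0 <= m < k) rnorm h (x' m) `^ p -
    \sum_(0 <= m < k) rnorm h (x m) `^ p) @ \oo --> rnorm h x' `^ p - rnorm h x `^ p.
  by apply: cvgB; exact: dsum_powR_series_cvg.
rewrite -(cvg_lim _ H)//; apply/cvg_lim => //.
apply: cvg_near_cst; near=> k.
rewrite -sumrB (sum_single _ (n := n)) => [|m mn].
  by rewrite x'E dsum_singleE ifT//; near: k; exact: nbhs_infty_gt.
by rewrite x'E dsum_single_neq// addr0 subrr.
Unshelve. all: by end_near. Qed.

Section dual.
Variables (F : Z -> K^o) (x : Z).
Hypothesis lF : linear F.
Hypothesis F1 : forall z, abs (F z) <= rnorm h z.
Hypothesis Fx : re (F x) = rnorm h x.

Local Notation N := (rnorm h x).
Local Notation g n := (fun v : X n => F (dsum_single v)).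

Lemma dsum_dual_linear n : linear (g n).
Proof. by move=> k u v /=; rewrite dsum_single_linear lF. Qed.

Lemma dsum_dual_sum_cvg z :
  (fun k => \sum_(0 <= n < k) F (dsum_single (z n))) @ \oo --> F z.
Proof.
apply/(cvg_rnormP h); apply/cvgrPdist_le => e e0.
move/cvgrPdist_le : (dsum_tail_norm_cvg z) => /(_ _ e0); apply: filterS => k.
rewrite !sub0r !normrN !ger0_norm ?rnorm_ge0//; apply: le_trans.
have -> : \sum_(0 <= n < k) F (dsum_single (z n)) =
    F (\sum_(0 <= n < k) dsum_single (z n)).
  apply/esym/(big_morph F) => [u v|]; [exact: linear_add|exact: linear_fun0].
by rewrite -linear_sub.
Qed.

(* Compare [N + re (g w) <= |x + w|] with the change of the n-th term of [|x|^p]. *)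
Lemma dsum_dual_increment n (w : X n) :
  N `^ (p - 1) * re (F (dsum_single w)) <=
  rnorm h (x n + w) `^ (p - 1) * (rnorm h (x n + w) - rnorm h (x n)).
Proof.
have p0 : 0 < p by rewrite (lt_le_trans ltr01).
rewrite -(ler_pM2l p0).
have : re (F (dsum_single w)) <= rnorm h (x + dsum_single w) - N.
  rewrite lerBrDl -Fx -real_partD -linear_add//.
  exact: le_trans (real_part_le _ _) (F1 _).
move: (dsum_single_norm x w) (rnorm_ge0 h (x + dsum_single w)).
move: (rnorm h (x + dsum_single w)) => N' N'E N'0 N'g.
apply: (@le_trans _ _ (p * (N `^ (p - 1) * (N' - N)))).
  by rewrite ler_pM2l//; apply: ler_wpM2l => //; exact: powR_ge0.
(* The tangent at [N] bounds the left side by the change of p-th powers; the tangent at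
   [rnorm h (x n + w)] bounds that change from above. *)
apply: le_trans (powR_tangent p1 N'0 (rnorm_ge0 h x)) _; rewrite N'E.
have := powR_tangent p1 (rnorm_ge0 h (x n)) (rnorm_ge0 h (x n + w)).
lra.
Qed.

(** Take the increment [w = t v], divide by [t], and let [t] tend to 0 from the right; the triangle
    inequality bounds the change of the n-th norm by [t |v|]. *)
Lemma dsum_dual_le n (v : X n) :
  N `^ (p - 1) * abs (F (dsum_single v)) <= rnorm h (x n) `^ (p - 1) * rnorm h v.
Proof.
have r0 : 0 <= p - 1 by rewrite subr_ge0.
pose G (v : X n) : K^o := of_real h (N `^ (p - 1)) * F (dsum_single v).
have lG : linear G.
  by move=> k u w; rewrite /G dsum_dual_linear mulrDr; congr +%R; exact: mulrCA.
have NG w : abs (G w) = N `^ (p - 1) * abs (F (dsum_single w)).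
  by rewrite /G rnormM rnorm_of_real ger0_norm// powR_ge0.
rewrite -NG; apply: linear_rnorm_le => // {}v.
rewrite [leLHS](real_partZ h) [leRHS]mulrC.
apply: (powR_affine_ge (rnorm_ge0 h (x n)) r0 (fun=> rnorm_ge0 h v)) => t /andP[t0 t1].
have := dsum_dual_increment (of_real h t *: v).
have -> : F (dsum_single (of_real h t *: v)) = of_real h t * F (dsum_single v).
  exact: (linear_scale _ _ (@dsum_dual_linear n)).
rewrite (real_partZ h) => H; rewrite -(ler_pM2l t0) mulrCA; apply: le_trans H _.
have := rnormD h (x n) (of_real h t *: v).
rewrite (rnorm_sublinear h).2 ?(ltW t0)// => bD.
set b := rnorm h (_ + _) in bD *; set a := rnorm h (x n) in bD *.
have b0 : 0 <= b := rnorm_ge0 _ _.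
have a0 : 0 <= a := rnorm_ge0 _ _.
rewrite [leRHS]mulrA [leRHS]mulrC.
apply: (@le_trans _ _ (b `^ (p - 1) * (t * rnorm h v))).
  by apply: ler_wpM2l; [exact: powR_ge0|rewrite lerBlDl].
apply: ler_wpM2r; first by apply: mulr_ge0; [exact: ltW|exact: rnorm_ge0].
by apply: (ge0_ler_powR r0 _ _ bD); rewrite nnegrE// (le_trans b0 bD).
Qed.

(** The increment [- t x n] scales the n-th norm exactly by [1 - t]; its negative sign yields the
    bound opposite to [dsum_dual_le]. *)
Lemma dsum_dual_self n :
  rnorm h (x n) `^ (p - 1) * rnorm h (x n) <=
  N `^ (p - 1) * re (F (dsum_single (x n))).
Proof.
have r0 : 0 <= p - 1 by rewrite subr_ge0.
rewrite -lerN2 [X in _ <= - X]mulrC -[leRHS]mulNr.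
apply: (@powR_affine_ge _ _ (- rnorm h (x n)) _ _ _ (rnorm_ge0 h (x n)) r0) => [->|t /andP[t0 t1]].
  by rewrite oppr0.
have := dsum_dual_increment (of_real h (- t) *: x n).
have -> : F (dsum_single (of_real h (- t) *: x n)) =
    of_real h (- t) * F (dsum_single (x n)).
  exact: (linear_scale _ _ (@dsum_dual_linear n)).
rewrite (real_partZ h) -[X in X + _ *: X]scale1r.
have -> : (1 *: x n + of_real h (- t) *: (1 *: x n)) = of_real h (1 - t) *: x n.
  by rewrite !scale1r of_realD of_real1 scalerDl scale1r.
rewrite (rnorm_sublinear h).2; last by rewrite subr_ge0 ltW.
set a := rnorm h (x n).
have -> : (1 - t) * a = a + t * - a by ring.
move=> H; rewrite -(ler_pM2l t0); lra.
Qed.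

(** [f n] is [F] on the n-th coordinate, rescaled by [(N / |x n|)^(p - 1)]: [dsum_dual_le] makes it
    contractive and [dsum_dual_self] makes it attain its norm at [x n]. *)
Lemma dsum_dual_support : exists f : forall n, X n -> K^o,
  forall n, x n != 0 -> support_functionals h (x n) (f n) /\
    forall v : X n, of_real h (N `^ (p - 1)) * F (dsum_single v) =
      of_real h (rnorm h (x n) `^ (p - 1)) * f n v.
Proof.
exists (fun n v => of_real h (N `^ (p - 1) / rnorm h (x n) `^ (p - 1)) * F (dsum_single v)).
move=> n xn0.
have a0 : 0 < rnorm h (x n) `^ (p - 1).
  apply: powR_gt0; rewrite lt_neqAle rnorm_ge0 andbT eq_sym.
  by apply: contra_neq xn0 => /rnorm0_eq0.
have c0 : 0 <= N `^ (p - 1) / rnorm h (x n) `^ (p - 1).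
  by rewrite divr_ge0 ?powR_ge0.
split; last first.
  by move=> v; rewrite [RHS]mulrA -of_realM mulrCA mulfV ?mulr1// gt_eqF.
set f := (X in support_functionals _ _ X).
have fle v : abs (f v) <= rnorm h v.
  rewrite /f rnormM rnorm_of_real (ger0_norm c0) mulrAC ler_pdivrMr//.
  by rewrite [leRHS]mulrC; exact: dsum_dual_le.
apply/(support_functionalsP _ _ xn0); split=> //.
  by move=> k u w; rewrite /f dsum_dual_linear mulrDr; congr +%R; exact: mulrCA.
apply/le_anti/andP; split; first exact: le_trans (real_part_le _ _) (fle _).
rewrite /f [leRHS](real_partZ h) mulrAC ler_pdivlMr// [leLHS]mulrC.
exact: dsum_dual_self.
Qed.

End dual.

End direct_sum_dual.

(** * The case [p = 0] *)

Section null_sequences.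
Context {R : realType} {K : numFieldType} (h : RorC R K) {p : R}.
Context (hp : p = 0 \/ 1 <= p) (X : nat -> normedModType K) (p0 : p = 0).

Local Notation Z := (direct_sum h hp X).
Local Notation re := (real_part h).
Local Notation abs z := (rnorm h (z : K^o)).
Implicit Types x y z : Z.

Let lp_norm0 a : lp_norm p a = lp_norm 0 a. Proof. by rewrite p0. Qed.

Lemma dsum0_coord_cvg z : (fun n => rnorm h (z n)) @ \oo --> (0 : R).
Proof.
have lp_mem0 a : lp_mem p a -> a @ \oo --> (0 : R) by rewrite /lp_mem p0 eqxx.
exact: lp_mem0 (dsum_memP z).
Qed.

Lemma dsum0_norm_le z M : (forall n, rnorm h (z n) <= M) -> rnorm h z <= M.
Proof. by move=> zM; rewrite dsum_normE lp_norm0; exact: lp_norm_c0_le. Qed.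

(** Strictness survives the supremum: all but finitely many coordinates are at most [M / 2], and the
    others have a maximum below [M]. *)
Lemma dsum0_norm_lt z M : 0 < M -> (forall n, rnorm h (z n) < M) -> rnorm h z < M.
Proof.
move=> M0 zM.
have [m _ zm] : \forall n \near \oo, rnorm h (z n) <= M / 2.
  have /cvgr_le : (fun n => rnorm h (z n)) @ \oo --> (0 : R) by exact: dsum0_coord_cvg.
  by apply; rewrite divr_gt0.
have [M' M'M zM'] : exists2 M', M' < M & forall n, (n < m)%N -> rnorm h (z n) <= M'.
  elim: m {zm} => [|m [M' M'M zM']]; first by exists 0.
  exists (Num.max M' (rnorm h (z m))); first by rewrite gt_max M'M zM.
  move=> n; rewrite ltnS leq_eqVlt => /predU1P[->|/zM' zn]; rewrite le_max ?lexx ?orbT//.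
  by rewrite zn.
apply: (@le_lt_trans _ _ (Num.max M' (M / 2))); last by rewrite gt_max M'M; lra.
apply: dsum0_norm_le => n; rewrite le_max.
by have [/zM' ->//|mn] := ltnP n m; rewrite (zm n mn) orbT.
Qed.

Lemma rnorm_affine_lt (V : normedModType K) (u v : V) M t s :
  rnorm h u <= M -> rnorm h (u + of_real h t *: v) < M -> 0 < s <= t ->
  rnorm h (u + of_real h s *: v) < M.
Proof.
move=> uM utM /andP[s0 st]; have t0 : 0 < t by exact: lt_le_trans st.
have q0 : 0 < s / t by exact: divr_gt0.
have q1 : s / t <= 1 by rewrite ler_pdivrMr// mul1r.
have -> : u + of_real h s *: v =
    of_real h (1 - s / t) *: u + of_real h (s / t) *: (u + of_real h t *: v).
  rewrite scalerDr scalerA -of_realM divfK ?gt_eqF// addrA -scalerDl -of_realD.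
  by rewrite subrK of_real1 scale1r.
apply: le_lt_trans (rnormD _ _ _) _; have sr := @rnorm_sublinear _ _ h V.
rewrite !sr.2 ?subr_ge0 ?(ltW q0)//.
have : s / t * rnorm h (u + of_real h t *: v) < s / t * M by rewrite ltr_pM2l.
have : (1 - s / t) * rnorm h u <= (1 - s / t) * M by rewrite ler_wpM2l ?subr_ge0.
lra.
Qed.

(** Far coordinates of [x] and [v] are at most [M / 4], so every step [t <= 1] keeps them below [M].
    For the finitely many others the smallest step works, since by convexity ([rnorm_affine_lt]) a
    step may be shortened. *)
Lemma dsum0_descent x (v : Z) :
  (forall n, exists2 t : R, 0 < t & rnorm h (x n + of_real h t *: v n) < rnorm h x) ->
  exists t : R, rnorm h (x + of_real h t *: v) < rnorm h x.
Proof.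
move=> xv; set M := rnorm h x.
have M0 : 0 < M.
  by have [t _] := xv 0%N; apply: le_lt_trans; exact: rnorm_ge0.
have [m _ xm] : \forall n \near \oo, rnorm h (x n) <= M / 4 /\ rnorm h (v n) <= M / 4.
  have M4 : 0 < M / 4 by rewrite divr_gt0.
  have zM (z : Z) : \forall n \near \oo, rnorm h (z n) <= M / 4.
    have /cvgr_le : (fun n => rnorm h (z n)) @ \oo --> (0 : R) by exact: dsum0_coord_cvg.
    exact.
  by near=> n; split; near: n; exact: zM.
have [t /andP[t0 t1] tm] : exists2 t : R, 0 < t <= 1 &
    forall n, (n < m)%N -> rnorm h (x n + of_real h t *: v n) < M.
  elim: m {xm} => [|m [t /andP[t0 t1] tm]].
    by exists 1 => //; rewrite ltr01 lexx.
  have [s s0 sm] := xv m; exists (Num.min s t).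
    by rewrite lt_min s0 t0 ge_min t1 orbT.
  move=> n; rewrite ltnS leq_eqVlt => /predU1P[->|/tm nM].
    apply: rnorm_affine_lt (dsum_norm_coord _ _) sm _.
    by rewrite lt_min s0 t0 ge_min lexx.
  apply: rnorm_affine_lt (dsum_norm_coord _ _) nM _.
  by rewrite lt_min s0 t0 ge_min lexx orbT.
exists t; apply: dsum0_norm_lt => // n.
have -> : (x + of_real h t *: v) n = x n + of_real h t *: v n by [].
have [/tm//|/xm[xn vn]] := ltnP n m.
apply: le_lt_trans (rnormD _ _ _) _.
rewrite (rnorm_sublinear h).2 ?(ltW t0)//.
have := rnorm_ge0 h (v n); nra.
Unshelve. all: by end_near. Qed.

Lemma birkhoff_james_c0 x y : x != 0 ->
  birkhoff_james x y <->
  closed_conv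
    [set z : K^o | exists (n : nat) (f : X n -> K^o),
       [/\ extreme_points (support_functionals h (x n)) f,
           `|x n| = `|x| & z = f (y n)]]
    0.
Proof.
move=> x0; have M0 : 0 < rnorm h x.
  by rewrite lt_neqAle rnorm_ge0 andbT eq_sym; apply: contra_neq x0 => /rnorm0_eq0.
have normE n : `|x n| = `|x| -> rnorm h (x n) = rnorm h x by rewrite /rnorm => ->.
have xn0 n : `|x n| = `|x| -> x n != 0.
  by move=> nx; apply: contra_neq x0 => xn; apply/normr0_eq0; rewrite -nx xn normr0.
split=> [xy|xy k].
  apply/(closed_conv0P (h := h) (D := rnorm h y)).
    move=> _ [n [f [[Jf _] nx ->]]].
    have [_ f1 _] := (support_functionalsP h _ (xn0 _ nx)).1 Jf.
    exact: le_trans (f1 _) (dsum_norm_coord _ _).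
  move=> k d d0; apply: contrapT => kd.
  have [n|t] := @dsum0_descent x (k *: y).
    have [nx|nx] := pselect (`|x n| = `|x|).
      rewrite -(normE _ nx); apply: support_lt0_descent; first exact: xn0.
      move=> f ef; have [[lf _ _ _] _] := ef.
      have -> : f ((k *: y) n) = k * f (y n) by rewrite -linear_scale.
      rewrite ltNge; apply/negP => fy; apply: kd.
      by exists (f (y n)); [exists n, f|rewrite (lt_le_trans _ fy)// oppr_lt0].
    have {}nx : rnorm h (x n) < rnorm h x.
      rewrite lt_neqAle dsum_norm_coord andbT; apply/eqP => e; apply: nx.
      by rewrite -(rnormE h) e rnormE.
    have v1 : 0 < rnorm h ((k *: y) n) + 1 by have := rnorm_ge0 h ((k *: y) n); lra.
    have dx : 0 < rnorm h x - rnorm h (x n) by rewrite subr_gt0.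
    (* A coordinate of non-maximal norm may move by less than its gap to the maximum; the added 1
       makes the inequality strict and the denominator positive. *)
    exists ((rnorm h x - rnorm h (x n)) / (rnorm h ((k *: y) n) + 1)).
      exact: divr_gt0.
    apply: le_lt_trans (rnormD _ _ _) _.
    rewrite (rnorm_sublinear h).2; last by apply: ltW; exact: divr_gt0.
    rewrite -ltrBrDl mulrAC ltr_pdivrMr// ltr_pM2l//; lra.
  have := xy (of_real h t * k); rewrite (ler_rnorm h) -scalerA.
  by rewrite leNgt => /negP.
rewrite (ler_rnorm h); apply/ler_addgt0Pr => d d0.
(* One support functional at a maximal coordinate already bounds [|x + k y|] below by [|x| - d]. *)
have [_ [n [f [[Jf _] nx ->]]] fy] := closed_conv0_real_part h xy k d0.
have [lf f1 fx] := (support_functionalsP h _ (xn0 _ nx)).1 Jf.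
rewrite -(normE _ nx) -fx.
apply: (@le_trans _ _ (rnorm h ((x + k *: y) n) + d)); last first.
  by rewrite lerD2r; exact: dsum_norm_coord.
have -> : (x + k *: y) n = x n + k *: y n by [].
have := le_trans (real_part_le h _) (f1 (x n + k *: y n)).
rewrite linear_add// linear_scale// real_partD; lra.
Qed.

End null_sequences.

(** * The cases [p > 1] and [p = 1] *)

Section power_sums.
Context {R : realType} {K : numFieldType} (h : RorC R K) {p : R}.
Context (hp : p = 0 \/ 1 <= p) (X : nat -> normedModType K) (p1 : 1 <= p).

Local Notation Z := (direct_sum h hp X).
Local Notation re := (real_part h).
Local Notation abs z := (rnorm h (z : K^o)).
Implicit Types x y z : Z.

Let p_gt0 : 0 < p. Proof. exact: lt_le_trans p1. Qed.
Let p_neq0 : p != 0. Proof. by rewrite gt_eqF. Qed.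
Let pB1_ge0 : 0 <= p - 1. Proof. by rewrite subr_ge0. Qed.

Definition pairing_term x y (f : forall n, X n -> K^o) n : K :=
  of_real h (rnorm h (x n) `^ (p - 1)) * f n (y n).

Section pairing.
Variables (x y : Z) (f : forall n, X n -> K^o).
Hypothesis Jf : forall n, x n != 0 -> support_functionals h (x n) (@f n).

Local Notation u := (pairing_term x y f).
Local Notation D := (rnorm h x `^ p + rnorm h y `^ p).
Let d n := rnorm h (x n) `^ p + rnorm h (y n) `^ p.

Let fJ n : x n != 0 ->
  [/\ linear (@f n), (forall v, abs (@f n v) <= rnorm h v) & re (f (x n)) = rnorm h (x n)].
Proof. by move=> xn; apply/(support_functionalsP h _ xn); exact: Jf. Qed.

Let ud n : x n != 0 -> abs (u n) <= d n.
Proof.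
move=> /fJ[_ f1 _]; rewrite /pairing_term rnormM rnorm_of_real ger0_norm ?powR_ge0//.
apply: le_trans (powRB1_mul_le p1 (rnorm_ge0 h _) (rnorm_ge0 h _)).
by apply: ler_wpM2l; [exact: powR_ge0|exact: f1].
Qed.

Let d0 n : 0 <= d n. Proof. by rewrite addr_ge0// powR_ge0. Qed.

Let dD n : \sum_(0 <= i < n) d i <= D.
Proof. by rewrite big_split/= lerD// dsum_powR_series_le. Qed.

Lemma pairing_cvg : (fun n => \sum_(0 <= i < n | x i != 0) u i) @ \oo -->
  (\big[+%R/0]_(0 <= i <oo | x i != 0) u i : K^o).
Proof. exact: abs_summable_cvg ud d0 dD. Qed.

Lemma pairing_le : abs (\big[+%R/0]_(0 <= i <oo | x i != 0) u i) <= D.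
Proof.
apply: (cvgr_to_le (rnorm_cvg (h := h) pairing_cvg)); apply: nearW => n.
apply: le_trans (dD n); rewrite big_mkcond/=.
elim/big_rec2: _ => [|i a b _ ba]; first by rewrite rnorm0.
apply: le_trans (rnormD _ _ _) _; apply: lerD => //.
by case: ifPn => [/ud//|_]; rewrite rnorm0.
Qed.

(** Termwise tangent inequality at [|x i|], combined with [|x i + y i| >= |x i| + re (f (y i))].
    Terms with [x i = 0] contribute exactly [|y i|^p]. *)
Lemma dsum_series_lower_bound n :
  \sum_(0 <= i < n) rnorm h (x i) `^ p +
    (p * re (\sum_(0 <= i < n | x i != 0) u i) +
     \sum_(0 <= i < n | x i == 0) rnorm h (y i) `^ p) <=
  \sum_(0 <= i < n) rnorm h (x i + y i) `^ p.
Proof.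
have -> : p * re (\sum_(0 <= i < n | x i != 0) u i) =
    \sum_(0 <= i < n) if x i != 0 then p * re (u i) else 0.
  by rewrite real_part_sum mulr_sumr big_mkcond.
rewrite [X in _ + (_ + X)]big_mkcond -!big_split/=; apply: ler_sum => i _.
have [xi|xi] := eqVneq (x i) 0.
  by rewrite xi rnorm0 powR0// !add0r.
have [lf f1 fx] := fJ xi.
rewrite addr0 [re (u i)]real_partZ -lerBrDl mulrCA [X in X <= _]mulrCA.
have := powR_tangent p1 (rnorm_ge0 h (x i + y i)) (rnorm_ge0 h (x i)).
apply: le_trans; rewrite ler_pM2l// ler_wpM2l ?powR_ge0//.
have := le_trans (real_part_le h _) (f1 (x i + y i)).
by rewrite linear_add// real_partD fx; lra.
Qed.

Lemma pairing_termZ k n : x n != 0 ->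
  pairing_term x (k *: y) f n = k * u n.
Proof.
by move=> /fJ[lf _ _]; rewrite /pairing_term mulrCA -(linear_scale k (y n) lf).
Qed.

End pairing.

(** The sequence [w] is a minorant of the contribution of the zero coordinates: 0 when [p > 1], and
    [|k|] times the partial sums of [|y i|] when [p = 1]. *)
Lemma dsum_norm_lower_bound x y (f : forall n, X n -> K^o) k (w : R ^nat) (l : R) :
  (forall n, x n != 0 -> support_functionals h (x n) (f n)) ->
  (forall n, w n <= \sum_(0 <= i < n | x i == 0) rnorm h ((k *: y) i) `^ p) ->
  w @ \oo --> l ->
  rnorm h x `^ p +
    (p * re (k * \big[+%R/0]_(0 <= i <oo | x i != 0) pairing_term x y f i) + l) <=
  rnorm h (x + k *: y) `^ p.
Proof.
move=> Jf wle wl.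
have cu := real_part_cvg (h := h) (k := k) (pairing_cvg (y := y) Jf).
have cx := dsum_powR_series_cvg (z := x) p_neq0.
have cxy := dsum_powR_series_cvg (z := x + k *: y) p_neq0.
apply: (ler_cvg_to (cvgD cx (cvgD (cvgM (cvg_cst p) cu) wl)) cxy).
apply: nearW => n; apply: le_trans (dsum_series_lower_bound (k *: y) Jf n).
rewrite lerD2l lerD// le_eqVlt; apply/orP; left; apply/eqP; congr (_ * re _).
by rewrite mulr_sumr; apply: eq_bigr => i xi; rewrite (pairing_termZ _ Jf).
Qed.

Theorem birkhoff_james_lp x y : 1 < p ->
  birkhoff_james x y <->
  closed_conv
    [set z : K^o | exists f : forall n, X n -> K^o,
       (forall n, x n != 0 ->
          extreme_points (support_functionals h (x n)) (f n)) /\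
       z = \big[+%R/0]_(0 <= n <oo | x n != 0) pairing_term x y f n]
    0.
Proof.
move=> p_gt1; split=> [xy|xy k].
  apply/(closed_conv0P (h := h) (D := rnorm h x `^ p + rnorm h y `^ p)).
    by move=> _ [f [ef ->]]; apply: pairing_le => n /ef[].
  move=> k d d0.
  (* The support functionals coming from [F] need not be extreme; in each coordinate they are
     replaced by an extreme one that does at least as well in the direction [k *: y n]. *)
  have ex n : exists e : X n -> K^o, x n != 0 ->
      extreme_points (support_functionals h (x n)) e /\
      forall g, support_functionals h (x n) g -> re (g (k *: y n)) <= re (e (k *: y n)).
    have [->|xn] := eqVneq (x n) 0; first by exists 0 => /eqP.
    by have [e eP] := extreme_support_ge h (k *: y n) xn; exists e.
  pose e n := sval (cid (ex n)).
  have eP n : x n != 0 -> _ := svalP (cid (ex n)).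
  have Je n : x n != 0 -> support_functionals h (x n) (e n) by move=> /eP[[]].
  exists (\big[+%R/0]_(0 <= n <oo | x n != 0) pairing_term x y e n).
    by exists e; split=> // n /eP[].
  apply: (@lt_le_trans _ _ 0); first by rewrite oppr_lt0.
  have [F [lF F1 Fx Fy]] := birkhoff_james_functional h xy.
  have [g gP] := dsum_dual_support p1 lF F1 Fx.
  have Fc := dsum_dual_sum_cvg p1 lF F1 (z := k *: y).
  rewrite linear_scale// Fy mulr0 in Fc.
  have := real_part_cvg (h := h) (k := of_real h (rnorm h x `^ (p - 1))) Fc.
  rewrite mulr0 real_part0 => {}Fc.
  apply: (ler_cvg_to Fc (real_part_cvg (h := h) (k := k) (pairing_cvg (y := y) Je))).
  apply: nearW => n; rewrite !mulr_sumr !real_part_sum [leRHS]big_mkcond/=.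
  apply: ler_sum => i _; case: ifPn => [xi|/negPn/eqP xi].
    have [Jg gE] := gP i xi; rewrite gE -(pairing_termZ y Je)//.
    rewrite [leLHS]real_partZ [leRHS]real_partZ ler_wpM2l ?powR_ge0//.
    by have [_ ] := eP i xi; apply.
  apply: le_trans (real_part_le h _) _; rewrite rnormM rnorm_of_real.
  rewrite ger0_norm ?powR_ge0//.
  apply: le_trans (dsum_dual_le p1 lF F1 Fx _) _.
  by rewrite xi rnorm0 powR0 ?mul0r// subr_eq0 gt_eqF.
have powR_le (a b : R) : 0 <= a -> 0 <= b -> a `^ p <= b `^ p -> a <= b.
  move=> a0 b0; rewrite !leNgt; apply: contra => ba.
  by apply: gt0_ltr_powR; rewrite ?nnegrE.
rewrite (ler_rnorm h); apply: (powR_le _ _ (rnorm_ge0 h x) (rnorm_ge0 h _)).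
apply/ler_addgt0Pr => d d0.
have [_ [f [ef ->]] fd] := closed_conv0_real_part h xy k (divr_gt0 d0 p_gt0).
have Jf n : x n != 0 -> support_functionals h (x n) (f n) by move=> /ef[].
have w0 n : 0 <= \sum_(0 <= i < n | x i == 0) rnorm h ((k *: y) i) `^ p.
  by apply: sumr_ge0 => i _; exact: powR_ge0.
have key (a b r : R) : - (d / p) < r -> a + (p * r + 0) <= b -> a <= b + d.
  by rewrite -mulNr ltr_pdivrMr// [r * p]mulrC; lra.
exact: key fd (dsum_norm_lower_bound Jf w0 (cvg_cst 0)).
Qed.

Theorem birkhoff_james_l1 x y : p = 1 ->
  birkhoff_james x y <->
  exists f : forall n, X n -> K^o,
    (forall n, x n != 0 -> support_functionals h (x n) (f n)) /\
    `|\big[+%R/0]_(0 <= n <oo | x n != 0) f n (y n)|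
      <= \big[+%R/0]_(0 <= n <oo | x n == 0) `|y n|.
Proof.
move=> p_eq1.
have pw1 (r : R) : 0 <= r -> r `^ p = r by move=> r0; rewrite p_eq1 powRr1.
have pw0 (r : R) : r `^ (p - 1) = 1 by rewrite p_eq1 subrr powRr0.
have pairingE (f : forall n, X n -> K^o) n : pairing_term x y f n = f n (y n).
  by rewrite /pairing_term pw0 of_real1 mul1r.
have pairing_sumE (f : forall n, X n -> K^o) :
    \big[+%R/0]_(0 <= n <oo | x n != 0) f n (y n) =
    \big[+%R/0]_(0 <= n <oo | x n != 0) pairing_term x y f n :> K^o.
  apply: (congr1 (fun s : nat -> K^o => limn s)).
  by apply/funext => n; apply: eq_bigr => i _; rewrite pairingE.
set T : K := \big[+%R/0]_(0 <= n <oo | x n == 0) `|y n|.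
have cT : (fun n => \sum_(0 <= i < n | x i == 0) `|y i|) @ \oo --> (T : K^o).
  apply: (@abs_summable_cvg _ _ h (fun i => x i == 0) _ (fun i => rnorm h (y i)) (rnorm h y)).
  - by move=> n _; rewrite -(rnormE h (y n)) rnorm_of_real ger0_norm// rnorm_ge0.
  - by move=> n; exact: rnorm_ge0.
  - move=> n; have := dsum_powR_series_le y n p_neq0.
    rewrite pw1 ?rnorm_ge0//; apply: le_trans; apply: ler_sum => i _.
    by rewrite pw1 ?rnorm_ge0.
have sumE n : re (1 * \sum_(0 <= i < n | x i == 0) `|y i|) =
    \sum_(0 <= i < n | x i == 0) rnorm h (y i).
  by rewrite mul1r real_part_sum.
have cT' : (fun n => \sum_(0 <= i < n | x i == 0) rnorm h (y i)) @ \oo --> re T.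
  have := real_part_cvg (h := h) (k := 1) cT; rewrite mul1r.
  by under eq_fun do rewrite sumE.
(* [T] is a limit of embedded reals, hence real, so comparisons with it in [K] can be read in
   [R]. *)
have TE : of_real h (re T) = T.
  have := of_real_cvg (h := h) cT'.
  under eq_fun do rewrite of_real_sum; under eq_fun do under eq_bigr do rewrite rnormE.
  by move=> H; apply: (cvg_unique _ H cT).
have normTE (z : K) : (`|z| <= T) = (abs z <= re T).
  by rewrite -TE -(rnormE h (z : K^o)) ler_of_real of_realK.
split=> [xy|[f [Jf fT]] k].
  have [F [lF F1 Fx Fy]] := birkhoff_james_functional h xy.
  have [g gP] := dsum_dual_support p1 lF F1 Fx.
  have Jg n : x n != 0 -> support_functionals h (x n) (g n) by move=> /gP[].
  exists g; split=> //; rewrite normTE pairing_sumE.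
  have Fc := dsum_dual_sum_cvg p1 lF F1 (z := y); rewrite Fy in Fc.
  have cg := rnorm_cvg (h := h) (pairing_cvg (y := y) Jg).
  have cR : (fun n => abs (\sum_(0 <= i < n) F (dsum_single h hp p1 (y i))) +
      \sum_(0 <= i < n | x i == 0) rnorm h (y i)) @ \oo --> 0 + re T.
    apply: cvgD cT'; have := rnorm_cvg (h := h) Fc.
    by rewrite rnorm0.
  rewrite add0r in cR.
  apply: (ler_cvg_to cg cR); apply: nearW => n.
  (* The full sums of [F] over coordinates tend to [F y = 0], so in the limit the part with
     [x i != 0] is minus the part with [x i = 0], where [F] is contractive. *)
  have -> : \sum_(0 <= i < n | x i != 0) pairing_term x y g i =
      \sum_(0 <= i < n) F (dsum_single h hp p1 (y i)) -
      \sum_(0 <= i < n | x i == 0) F (dsum_single h hp p1 (y i)).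
    rewrite [in RHS](bigID (fun i => x i == 0))/= [RHS]addrC addKr.
    apply: eq_bigr => i xi; rewrite pairingE.
    have [_ /(_ (y i))] := gP i xi.
    by rewrite !pw0 of_real1 !mul1r.
  apply: le_trans (rnormD _ _ _) _; rewrite rnormN lerD2l.
  elim/big_rec2: _ => [|i a b _ ba]; first by rewrite rnorm0.
  apply: le_trans (rnormD _ _ _) _; apply: lerD => //.
  by have := dsum_dual_le p1 lF F1 Fx (y i); rewrite !pw0 !mul1r.
rewrite (ler_rnorm h).
have wle n : abs k * (\sum_(0 <= i < n | x i == 0) rnorm h (y i)) <=
    \sum_(0 <= i < n | x i == 0) rnorm h ((k *: y) i) `^ p.
  rewrite mulr_sumr; apply: ler_sum => i _.
  by rewrite pw1 ?rnorm_ge0// rnormZ.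
(* Used with [c = |k|], [t = T], [c'] the modulus of the pairing sum and [r] the real part of [k]
   times that sum; then [r + c * t >= 0]. *)
have key (a b c c' r t : R) : a `^ p + (p * r + c * t) <= b `^ p ->
    0 <= a -> 0 <= b -> `|r| <= c * c' -> 0 <= c -> c' <= t -> a <= b.
  move=> + a0 b0; rewrite !pw1// p_eq1 ler_norml => + /andP[+ _]; nra.
have cw : (fun n => abs k * \sum_(0 <= i < n | x i == 0) rnorm h (y i)) @ \oo -->
    abs k * re T.
  by apply: cvgM cT'; exact: cvg_cst.
have lb := dsum_norm_lower_bound Jf wle cw.
refine (key _ _ _ (abs (\big[+%R/0]_(0 <= i <oo | x i != 0) pairing_term x y f i))
  _ _ lb (rnorm_ge0 h _) (rnorm_ge0 h _) _ (rnorm_ge0 h _) _).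
  by rewrite -rnormM; exact: real_part_normr_le.
by move: fT; rewrite normTE pairing_sumE.
Qed.

End power_sums.

Theorem theorem19 (R : realType) (K : numFieldType) (hK : RorC R K)
    (X : nat -> normedModType K)
    (X_nontrivial : forall n, exists v : X n, v != 0)
    (p : R) (hp : p = 0 \/ 1 <= p)
    (x y : direct_sum hK hp X) :
  [/\ 1 < p ->
      (birkhoff_james x y <->
       closed_conv
         [set z : K^o | exists f : forall n, X n -> K^o,
            (forall n, x n != 0 ->
               extreme_points (support_functionals hK (x n)) (f n)) /\
            z = \big[+%R/0]_(0 <= n <oo | x n != 0)
                  (of_real hK (rnorm hK (x n) `^ (p - 1)) * f n (y n))]
         0),
      p = 1 ->
      (birkhoff_james x y <->
       exists f : forall n, X n -> K^o,
         (forall n, x n != 0 -> support_functionals hK (x n) (f n)) /\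
         `|\big[+%R/0]_(0 <= n <oo | x n != 0) f n (y n)|
           <= \big[+%R/0]_(0 <= n <oo | x n == 0) `|y n|)
    & p = 0 -> x != 0 ->
      (birkhoff_james x y <->
       closed_conv
         [set z : K^o | exists (n : nat) (f : X n -> K^o),
            [/\ extreme_points (support_functionals hK (x n)) f,
                `|x n| = `|x| & z = f (y n)]]
         0)].
Proof.
split=> [p1|p1|p0 x0].
- exact: birkhoff_james_lp (ltW p1) _ _ p1.
- have p1' : 1 <= p by rewrite p1.
  exact: birkhoff_james_l1.
- exact: birkhoff_james_c0.
Qed.
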